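(* Let $d\in\mathbb{N}$, let $\boldsymbol{C}=(C_{\boldsymbol{i}})_{\boldsymbol{i}\in\mathbb{Z}^d}$ be an arbitrary random element of $l_0$ and let $\alpha>0$ be such that $$c:=\sum_{\boldsymbol{k}\in\mathbb{Z}^d}\mathbb{E}\left[|C_{\boldsymbol{k}}|^{\alpha}\right]\in(0,\infty).$$ Moreover, assume that $\kappa$ is a $\{-1,1\}$-valued random variable independent of $\boldsymbol{C}$. Consider, for a random element $\boldsymbol{\Theta}$ of $l_0$, the property $$(\ast)\qquad\mathbb{E}[h(\boldsymbol{\Theta})]=\frac1c\,\mathbb{E}\left[\sum_{\boldsymbol{k}\in\mathbb{Z}^d}h\left(\frac{\varphi_{\boldsymbol{k}}\boldsymbol{C}\cdot\kappa}{|C_{\boldsymbol{k}}|}\right)\cdot|C_{\boldsymbol{k}}|^{\alpha}\right]\quad\text{for all measurable } h:l_0\to[0,\infty),$$ where the $\boldsymbol{k}$th summand is understood to be $0$ if $C_{\boldsymbol{k}}=0$. (i) Let $\boldsymbol{\Theta}$ be a random element of $l_0$ with distribution satisfying $(\ast)$. Then $\boldsymbol{\Theta}$ is necessarily a spectral tail process of some stationary regularly varying random field with tail index $\alpha$. (ii) Let $\boldsymbol{Q}$ be a random element of $l_0$ with distribution $$\mathbb{P}(\boldsymbol{Q}\in\cdot)=\frac{1}{\mathbb{E}[\|\boldsymbol{C}\|^{\alpha}]}\,\mathbb{E}\left[\mathbf{1}\left\{\frac{\boldsymbol{C}\cdot\kappa}{\|\boldsymbol{C}\|}\in\cdot\right\}\cdot\|\boldsymbol{C}\|^{\alpha}\right].$$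 If $\boldsymbol{Y}$ is a tail process in $l_0$ with tail index $\alpha$ and whose spectral tail process $\boldsymbol{\Theta}$ satisfies $(\ast)$, then $\boldsymbol{Q}$ is one representative of the anchored spectral tail process (of $\boldsymbol{Y}$). Moreover, the extremal index $\vartheta$ of $\boldsymbol{Y}$ satisfies $$\vartheta=\frac{\mathbb{E}[\|\boldsymbol{C}\|^{\alpha}]}{\sum_{\boldsymbol{k}\in\mathbb{Z}^d}\mathbb{E}\left[|C_{\boldsymbol{k}}|^{\alpha}\right]}.$$
   Context: $\mathbb{R}^{\mathbb{Z}^d}$ carries the product $\sigma$-algebra; $|\boldsymbol{i}|=\max_k|i_k|$ for $\boldsymbol{i}\in\mathbb{Z}^d$. $l_0=\{\boldsymbol{x}\in\mathbb{R}^{\mathbb{Z}^d}:\lim_{|\boldsymbol{i}|\to\infty}|x_{\boldsymbol{i}}|=0\}$ with norm $\|\boldsymbol{x}\|=\max_{\boldsymbol{i}}|x_{\boldsymbol{i}}|$. The shift is $\varphi_{\boldsymbol{k}}\boldsymbol{x}=(x_{\boldsymbol{i}+\boldsymbol{k}})_{\boldsymbol{i}\in\mathbb{Z}^d}$. In the law of $\boldsymbol{Q}$ the integrand is $0$ when $\|\boldsymbol{C}\|=0$. $\mathrm{e}(\boldsymbol{x})=\{\boldsymbol{k}:|x_{\boldsymbol{k}}|>1\}$, with cardinality $|\mathrm{e}(\boldsymbol{x})|$; $\mathcal{E}_0=\{\boldsymbol{x}\in\mathbb{R}^{\mathbb{Z}^d}:|x_{\boldsymbol{0}}|>1,|\mathrm{e}(\boldsymbol{x})|<\infty\}$.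 Tail process: $\boldsymbol{Y}=(Y_{\boldsymbol{i}})_{\boldsymbol{i}\in\mathbb{Z}^d}$ is the tail process of a (strictly) stationary real-valued random field $\boldsymbol{X}$ if $\mathbb{P}(|Y_{\boldsymbol{0}}|>1)=1$ and, for every $m\in\mathbb{N}$, the conditional distribution of $(u^{-1}X_{\boldsymbol{i}})_{\boldsymbol{i}\in\{-m,\dots,m\}^d}$ given $|X_{\boldsymbol{0}}|>u$ converges weakly, as $u\to\infty$, to the distribution of $(Y_{\boldsymbol{i}})_{\boldsymbol{i}\in\{-m,\dots,m\}^d}$. A stationary field admitting a tail process is called regularly varying. It is known that then $|Y_{\boldsymbol{0}}|$ is $\mathrm{Pareto}(\alpha)$-distributed ($\mathbb{P}(|Y_{\boldsymbol{0}}|>y)=y^{-\alpha}$, $y\ge1$) for some $\alpha>0$, called the tail index, and independent of the spectral tail process $\boldsymbol{\Theta}=\boldsymbol{Y}/|Y_{\boldsymbol{0}}|$. Anchoring function: a measurable map $A:\mathcal{E}_0\to\mathbb{Z}^d$ such that for all $\boldsymbol{x}\in\mathcal{E}_0$, $A(\boldsymbol{x})\in\mathrm{e}(\boldsymbol{x})$ and $A(\varphi_{\boldsymbol{k}}\boldsymbol{x})+\boldsymbol{k}=A(\boldsymbol{x})$ for all $\boldsymbol{k}\in\mathrm{e}(\boldsymbol{x})$. For a tail process $\boldsymbol{Y}$ in $l_0$, $\boldsymbol{Z}^A$ denotes a random element of $\mathcal{E}_0$ with distribution $\mathbb{P}(\boldsymbol{Y}\in\cdot\mid A(\boldsymbol{Y})=\boldsymbol{0})$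 (the anchored process), and $\boldsymbol{Q}^A=\boldsymbol{Z}^A/\|\boldsymbol{Z}^A\|$. A random element $\boldsymbol{Q}$ of $l_0$ is a representative of the anchored spectral tail process of $\boldsymbol{Y}$ if $\mathbb{E}[h(\boldsymbol{Q})]=\mathbb{E}[h(\boldsymbol{Q}^A)]$ for all measurable $h:l_0\to[0,\infty)$ which are shift-invariant (i.e. $h(\varphi_{\boldsymbol{k}}\boldsymbol{x})=h(\boldsymbol{x})$ for all $\boldsymbol{x},\boldsymbol{k}$), for some (equivalently, every) anchoring function $A$. The (candidate) extremal index of $\boldsymbol{Y}$ is $\vartheta=\mathbb{E}[|\mathrm{e}(\boldsymbol{Y})|^{-1}]$, which equals $\mathbb{P}(A(\boldsymbol{Y})=\boldsymbol{0})>0$ for every $A$. *)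

(* Defs.v *)
From HB Require Import structures.
From mathcomp Require Import all_boot all_order all_algebra.
From mathcomp Require Import finmap.
From mathcomp Require Import all_classical all_reals all_analysis.
Set Implicit Arguments.
Unset Strict Implicit.
Unset Printing Implicit Defensive.
Import Order.TTheory GRing.Theory Num.Theory numFieldNormedType.Exports.
Local Open Scope classical_set_scope.
Local Open Scope ring_scope.

Notation Zd d := 'rV[int]_d.

Definition absZ (d : nat) (i : Zd d) : nat := (\max_(k < d) `|i ord0 k|)%N.

Definition coordinate_sets (R : realType) (d : nat) : set (set (Zd d -> R)) :=
  [set A | exists (i : Zd d) (B : set R),
     measurable B /\ A = [set x | B (x i)]].

(** R^(Z^d) with its product sigma-algebra. *)
Definition Zdfield (R : realType) (d : nat) :=
  g_sigma_algebraType (@coordinate_sets R d).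

Definition fshift (R : realType) (d : nat) (k : Zd d) (x : Zdfield R d) :
  Zdfield R d := fun i => x (i + k).

Definition fscale (R : realType) (d : nat) (a : R) (x : Zdfield R d) :
  Zdfield R d := fun i => a * x i.

Definition l0 (R : realType) (d : nat) : set (Zdfield R d) :=
  [set x | forall e : R, 0 < e ->
     exists n : nat, forall i : Zd d, (n <= absZ i)%N -> `|x i| < e].

(** On [l0] the supremum is finite and attained. *)
Definition fnorm (R : realType) (d : nat) (x : Zdfield R d) : R :=
  sup [set `|x i| | i in [set: Zd d]].

Definition exceed (R : realType) (d : nat) (x : Zdfield R d) : set (Zd d) :=
  [set k | 1 < `|x k|].

Definition E0 (R : realType) (d : nat) : set (Zdfield R d) :=
  [set x | 1 < `|x 0| /\ finite_set (exceed x)].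

Section Processes.
Context (R : realType) (d : nat).

(** The Borel sigma-algebra of the separable Banach space l_0 is the trace of
    the product sigma-algebra, so a random element of l_0 is a measurable map
    to [Zdfield R d] with values in [l0]. *)
Definition random_element_l0 (dO : measure_display) (O : measurableType dO)
    (C : O -> Zdfield R d) : Prop :=
  measurable_fun setT C /\ forall w, l0 (C w).

(** A measurable h : l_0 -> [0, oo), represented by a function on the whole of
    [Zdfield R d] whose values outside [l0] are irrelevant. *)
Definition l0_test (h : Zdfield R d -> R) : Prop :=
  measurable_fun (@l0 R d) h /\ forall x, l0 x -> 0 <= h x.

Definition shift_invariant (h : Zdfield R d -> R) : Prop :=
  forall x k, l0 x -> h (fshift k x) = h x.

Definition independent_rv (dO dS dT : measure_display)
    (O : measurableType dO) (S : measurableType dS) (T : measurableType dT)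
    (P : probability O R) (X : O -> S) (Y : O -> T) : Prop :=
  forall (A : set S) (B : set T), measurable A -> measurable B ->
    P (X @^-1` A `&` Y @^-1` B) = (P (X @^-1` A) * P (Y @^-1` B))%E.

Definition same_law (dO dO' dT : measure_display)
    (O : measurableType dO) (O' : measurableType dO') (T : measurableType dT)
    (P : probability O R) (X : O -> T) (P' : probability O' R) (X' : O' -> T) :
    Prop :=
  forall B : set T, measurable B -> P (X @^-1` B) = P' (X' @^-1` B).

Definition stationary (dO : measure_display) (O : measurableType dO)
    (P : probability O R) (X : O -> Zdfield R d) : Prop :=
  measurable_fun setT X /\ forall k : Zd d, same_law P X P (fshift k \o X).

Definition box (m : nat) := {i : Zd d | (absZ i <= m)%N}.

(** The box is finite, so the pointwise topology below is the usual topology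
    of R^box. *)
Definition box_restr (m : nat) (x : Zdfield R d) : {ptws box m -> R} :=
  fun i => x (val i).

(** [PY, Y] is the tail process of the field [PX, X]; weak convergence is
    convergence of expectations of bounded continuous functions, and the
    conditional expectation given |X_0| > u is the elementary one. *)
Definition tail_process
    (dX dY : measure_display) (OX : measurableType dX) (OY : measurableType dY)
    (PX : probability OX R) (X : OX -> Zdfield R d)
    (PY : probability OY R) (Y : OY -> Zdfield R d) : Prop :=
  [/\ measurable_fun setT Y,
      PY [set w | 1 < `|Y w 0|] = 1%E,
      (forall u : R, (0 < PX [set w | u < `|X w 0|]%R)%E) &
      forall (m : nat) (f : {ptws box m -> R} -> R),
        continuous f -> (exists M : R, forall x, `|f x| <= M) ->
        (\int[PX]_(w in [set w | u < `|X w 0|])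
             f (@box_restr m (fscale u^-1 (X w))))
          / fine (PX [set w | u < `|X w 0|])
        @[u --> +oo] --> \int[PY]_w f (@box_restr m (Y w))].

(** |Y_0| is Pareto(alpha)-distributed. *)
Definition tail_index (dY : measure_display) (OY : measurableType dY)
    (PY : probability OY R) (Y : OY -> Zdfield R d) (alpha : R) : Prop :=
  forall y : R, 1 <= y ->
    PY [set w | y < `|Y w 0|] = (y `^ (- alpha))%:E.

Definition spectral (y : Zdfield R d) : Zdfield R d := fscale `|y 0|^-1 y.

(** Tail processes are determined in law only, and so is the notion of being a
    spectral tail process. *)
Definition spectral_tail_process (dT : measure_display)
    (OT : measurableType dT) (PT : probability OT R) (Theta : OT -> Zdfield R d)
    (alpha : R) : Prop :=
  exists (dX dY : measure_display) (OX : measurableType dX)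
    (OY : measurableType dY) (PX : probability OX R) (X : OX -> Zdfield R d)
    (PY : probability OY R) (Y : OY -> Zdfield R d),
    [/\ stationary PX X, tail_process PX X PY Y, tail_index PY Y alpha &
        same_law PT Theta PY (@spectral \o Y)].

(** Only the values of A on [E0] matter; Z^d carries the discrete
    sigma-algebra. *)
Definition anchoring (A : Zdfield R d -> Zd d) : Prop :=
  [/\ (forall B : set (Zd d), measurable (@E0 R d `&` A @^-1` B)),
      (forall x, E0 x -> exceed x (A x)) &
      forall x, E0 x -> forall k, exceed x k -> A (fshift k x) + k = A x].

(** Y belongs to [E0] almost surely; the intersection with [E0] discards the
    values of A off its domain. *)
Definition anchored_at0 (A : Zdfield R d -> Zd d) : set (Zdfield R d) :=
  @E0 R d `&` [set x | A x = 0].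

(** The law P(Y \in . | A(Y) = 0) of the anchored process Z^A. *)
Definition anchored_law (dY : measure_display) (OY : measurableType dY)
    (PY : probability OY R) (Y : OY -> Zdfield R d) (A : Zdfield R d -> Zd d)
    (B : set (Zdfield R d)) : \bar R :=
  (PY (Y @^-1` (B `&` anchored_at0 A)) / PY (Y @^-1` anchored_at0 A))%E.

(** The right-hand side is E[h(Q^A)], with Q^A = Z^A / ||Z^A||.  As the
    property does not depend on A, it is required of every anchoring function,
    together with the existence of one, so that it also holds for some. *)
Definition anchored_spectral_representative
    (dY dQ : measure_display) (OY : measurableType dY) (OQ : measurableType dQ)
    (PY : probability OY R) (Y : OY -> Zdfield R d)
    (PQ : probability OQ R) (Q : OQ -> Zdfield R d) : Prop :=
  (exists A, anchoring A) /\
  forall A, anchoring A ->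
    forall h, l0_test h -> shift_invariant h ->
      ('E_PQ[h \o Q] =
       \int[anchored_law PY Y A]_(x in @l0 R d `&` @E0 R d)
         (h (fscale (fnorm x)^-1 x))%:E)%E.

(** [fset_set] sends a finite set to its list of elements (and an infinite set
    to the empty one); for Y in l_0, e(Y) is always finite, and it is almost
    surely nonempty. *)
Definition extremal_index (dY : measure_display) (OY : measurableType dY)
    (PY : probability OY R) (Y : OY -> Zdfield R d) : \bar R :=
  'E_PY[fun w => (#|` fset_set (exceed (Y w))|%fset%:R)^-1%R]%E.

(** Theta is a mixture of the rescaled shifts of C. *)
Definition mixture_representation
    (dO dT : measure_display) (O : measurableType dO) (OT : measurableType dT)
    (P : probability O R) (C : O -> Zdfield R d) (kappa : O -> R) (alpha c : R)
    (PT : probability OT R) (Theta : OT -> Zdfield R d) : Prop :=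
  forall h, l0_test h ->
    ('E_PT[h \o Theta] =
     (c^-1)%:E * \int[P]_w \esum_(k in [set: Zd d])
       (if C w k == 0 then 0%R
        else (h (fscale (kappa w / `|C w k|) (fshift k (C w)))
                * `|C w k| `^ alpha)%R)%:E)%E.

Definition tilted_law
    (dO dQ : measure_display) (O : measurableType dO) (OQ : measurableType dQ)
    (P : probability O R) (C : O -> Zdfield R d) (kappa : O -> R) (alpha : R)
    (PQ : probability OQ R) (Q : OQ -> Zdfield R d) : Prop :=
  forall B : set (Zdfield R d), measurable B ->
    PQ (Q @^-1` B) =
    ((\int[P]_w (if fnorm (C w) == 0 then 0%R
                 else (\1_B (fscale (kappa w / fnorm (C w)) (C w))
                         * fnorm (C w) `^ alpha)%R)%:E)
      / 'E_P[(fun w => fnorm (C w) `^ alpha)%R])%E.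

End Processes.

(* Main.v *)
From HB Require Import structures.
Require Import Defs.
From mathcomp Require Import finmap.
From mathcomp Require Import all_boot all_order all_algebra.
From mathcomp Require Import all_classical all_reals all_analysis.
From mathcomp Require Import measurable_realfun.
From mathcomp Require Import ring zify.
Set Implicit Arguments.
Unset Strict Implicit.
Unset Printing Implicit Defensive.
Import Order.TTheory GRing.Theory Num.Theory numFieldNormedType.Exports.
Local Open Scope classical_set_scope.
Local Open Scope ring_scope.

(** Everything rests on one identity.  Let [V] be Pareto distributed, written as
    [r^(-1/alpha)] with [r] uniform on the unit interval, and let [Theta] be the
    mixture of the rescaled shifts of [C].  Substituting [|C_k|^alpha r] for [r]
    turns the weight of the [k]th summand into the range of its radius, so that
    the law of [V Theta] becomes, up to the factor [1/c], the image of
    [P (x) Lebesgue (x) counting] under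
    [(w, r, k) |-> r^(-1/alpha) kappa (C seen from k)], restricted to the [k] at
    which this cluster exceeds 1 ([pareto_mixture]).

    Part (ii).  Comparing the limits that define a tail process along the levels
    [u] and [u y] shows that [Y / y] given [|Y_0| > y] has the law of [Y]
    ([tail_process_scaling]); hence [|Y_0|] and the spectral tail process are
    independent ([tail_process_polar]) and the identity applies to [Y].  For a
    fixed cluster the sum over [k] is a sum over the exceedance sites of one and
    the same field.  For the indicator of the event that the anchor lies at the
    origin, the equivariance of the anchoring function leaves exactly one term
    ([anchoring_unique]); for the inverse number of exceedances the terms add up
    to 1.  What remains depends on the direction of the cluster alone, and
    integrating out the radius gives the weight [|C|^alpha]
    ([tail_cluster_mean]).  This yields the law of the anchored process on
    shift-invariant events ([anchored_prob]) and the extremal index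
    ([extremal_indexE]).  Anchoring functions exist: take the lexicographically
    smallest exceedance site ([anchoring_exists]).

    Part (i).  A stationary field with tail process [V Theta] is obtained by
    repeating one cluster periodically.  Choose [w] and a radius [s] in the unit
    interval, make [C] periodic with a period that increases to infinity as [s]
    decreases to 0, scale it by [s^(-1/alpha) kappa], and shift it to a site
    chosen in one period with the counting measure; the periods grow so slowly
    that the total mass is finite.  Summing over a full period makes the field
    stationary ([moving_stationary]).  A height [u] at the origin forces [s] to
    be of the order [u^-alpha]; after the substitution [s = u^-alpha r] the period
    tends to infinity for fixed [r], and since [C] tends to 0 at infinity, the
    observed sum over a period is eventually equal to the sum in the identity
    above ([scaled_site_sum_near]).  Dominated convergence gives the tail process
    ([moving_tail_process]). *)

(** * Sums over a countable index set *)

Section CountableSums.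
Context (R : realType) (I : countType).
Local Open Scope ereal_scope.
Implicit Types f : I -> \bar R.

Lemma esum_nneseries f : (forall k, 0 <= f k) ->
  \esum_(k in [set: I]) f k = \sum_(n <oo) oapp f 0 (pickle_inv n).
Proof.
move=> f0; rewrite nneseries_esumT; last by move=> n; case: pickle_inv => /=.
transitivity (\esum_(n in range (@pickle I)) oapp f 0 (pickle_inv n)).
  rewrite (@reindex_esum _ _ _ [set: I] (range pickle) pickle).
    by apply: eq_esum => k _; rewrite pickleK_inv.
  split; [by move=> k _; exists k| |by move=> n [k _ <-]; exists k].
  by move=> x y _ _; exact: (pcan_inj pickleK_inv).
rewrite esum_mkcond; apply: eq_esum => n _; case: ifPn => //.
move=> /negP nr; case E: (pickle_inv n) => [k|//]; exfalso; apply: nr.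
by rewrite inE; exists k => //; move: (@pickle_invK I n); rewrite E.
Qed.

Lemma esumZl f (a : R) : (0 <= a)%R -> (forall k, 0 <= f k) ->
  \esum_(k in [set: I]) (a%:E * f k) = a%:E * \esum_(k in [set: I]) f k.
Proof.
move=> a0 f0; rewrite !esum_nneseries//; last by move=> k; rewrite mule_ge0.
rewrite -nneseriesZl; last by move=> n _; case: pickle_inv.
by apply: eq_eseriesr => n _; case: pickle_inv => //=; rewrite mule0.
Qed.

Lemma esum_eq1 f k : 0 <= f k -> (forall j, j != k -> f j = 0) ->
  \esum_(j in [set: I]) f j = f k.
Proof.
move=> fk0 f0; rewrite -[RHS](@esum_set1 _ _ k f)// [RHS]esum_mkcond.
apply: eq_esum => j _; case: ifPn => [//|]; rewrite notin_setE/= => /eqP jk.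
exact: f0.
Qed.

Lemma esum_ge1 f k : (forall j, 0 <= f j) -> f k <= \esum_(j in [set: I]) f j.
Proof.
move=> f0; rewrite -[leLHS](@esum_set1 _ _ k f)// [leLHS]esum_mkcond.
by apply: le_esum => // j _; case: ifPn.
Qed.

Context (d : measure_display) (T : measurableType d).

Lemma measurable_esum (f : I -> T -> \bar R) :
  (forall k, measurable_fun setT (f k)) -> (forall k x, 0 <= f k x) ->
  measurable_fun setT (fun x => \esum_(k in [set: I]) f k x).
Proof.
move=> mf f0; under eq_fun do rewrite esum_nneseries//.
rewrite (_ : (fun x => _) = fun x => \sum_(n <oo | n \in xpredT)
    oapp (fun k => f k x) 0 (pickle_inv n)); last first.
  by apply/funext => x; exact: eq_eseriesl.
apply: ge0_emeasurable_sum => [n x _ _|n _]; case: pickle_inv => //=.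
Qed.

Lemma integral_esum (mu : {measure set T -> \bar R}) (f : I -> T -> \bar R) :
  (forall k, measurable_fun setT (f k)) -> (forall k x, 0 <= f k x) ->
  \int[mu]_x (\esum_(k in [set: I]) f k x) =
  \esum_(k in [set: I]) \int[mu]_x f k x.
Proof.
move=> mf f0; rewrite esum_nneseries; last by move=> k; exact: integral_ge0.
under eq_integral do rewrite esum_nneseries//.
rewrite integral_nneseries//.
- by apply: eq_eseriesr => n _; case: pickle_inv => //=; rewrite integral0.
- by move=> n; case: pickle_inv => [k|] /=; [exact: mf|exact: measurable_cst].
- by move=> n x _; case: pickle_inv => [k|] /=.
Qed.

Lemma measurable_bigcup_countable (F : I -> set T) :
  (forall k, measurable (F k)) -> measurable (\bigcup_k F k).
Proof. by move=> mF; apply: countable_bigcupT_measurable. Qed.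

Lemma measurable_bigcap_countable (F : I -> set T) :
  (forall k, measurable (F k)) -> measurable (\bigcap_k F k).
Proof.
move=> mF; rewrite -[X in measurable X]setCK setC_bigcap.
by apply: measurableC; apply: measurable_bigcup_countable => k; exact: measurableC.
Qed.

(** A countable index may be chosen measurably: this is what makes a field read
    off at a random site measurable. *)
Lemma measurable_fun_diag (dS : measure_display) (S : measurableType dS)
    (F : I -> T -> S) (N : T -> I) :
  (forall k, measurable (N @^-1` [set k])) ->
  (forall k, measurable_fun setT (F k)) ->
  measurable_fun setT (fun x => F (N x) x).
Proof.
move=> mN mF _ B mB; rewrite setTI.
rewrite (_ : _ @^-1` B = \bigcup_k (N @^-1` [set k] `&` F k @^-1` B)); last first.
  apply/seteqP; split => [x Bx|x [k _ [/= <-]]//].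
  by exists (N x).
apply: measurable_bigcup_countable => k; apply: measurableI => //.
by rewrite -[X in measurable X]setTI; exact: mF.
Qed.

End CountableSums.

(** * Boxes and discrete tori *)

Section Torus1.
Variable m : nat.
Let p := (m.*2).+1.

Definition wrap1 (z : int) : 'I_p := (inZp 1 : 'I_p) *~ z.
(** Representatives centred at 0, so that one period is the box of radius [m]. *)
Definition unwrap1 (a : 'I_p) : int :=
  if (a <= m)%N then a%:Z else a%:Z - p%:Z.

Lemma val_wrap1 (n : nat) : wrap1 n%:Z = (n %% p)%N :> nat.
Proof. by rewrite /wrap1 -pmulrn Zp_mulrn /= modnMml mul1n. Qed.

Lemma wrap1K z : (`|z| <= m)%N -> unwrap1 (wrap1 z) = z.
Proof.
case: z => n zm.
  by rewrite /unwrap1 val_wrap1 modn_small ?ifT //; rewrite /p; lia.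
have -> : wrap1 (Negz n) = - wrap1 n.+1%:Z by rewrite NegzE /wrap1 mulrNz.
have E : (- wrap1 n.+1%:Z : 'I_p) = (p - n.+1)%N :> nat.
  rewrite /= val_wrap1 [(n.+1 %% p)%N]modn_small; last by rewrite /p; lia.
  by rewrite modn_small //; rewrite /p; lia.
by rewrite /unwrap1 E NegzE ifF /p; lia.
Qed.

Lemma unwrap1K a : wrap1 (unwrap1 a) = a.
Proof.
have E (b : 'I_p) : wrap1 b%:Z = b.
  by apply: val_inj; rewrite /= val_wrap1 modn_small.
rewrite /unwrap1; case: ifP => _; first exact: E.
rewrite /wrap1 mulrzBr -/(wrap1 _) E -/(wrap1 _).
suff -> : wrap1 p%:Z = 0 by rewrite subr0.
by apply: val_inj; rewrite /= val_wrap1 modnn.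
Qed.

Lemma unwrap1_bound a : (`|unwrap1 a| <= m)%N.
Proof. by rewrite /unwrap1; case: ifP; have := ltn_ord a; rewrite /p; lia. Qed.

End Torus1.

Section Torus.
Variables (d m : nat).

Definition torus := 'rV['I_(m.*2).+1]_d.
Definition wrap (i : Zd d) : torus := map_mx (@wrap1 m) i.
Definition unwrap (a : torus) : Zd d := map_mx (@unwrap1 m) a.

Lemma wrapD (i j : Zd d) : wrap (i + j) = wrap i + wrap j.
Proof. by apply/rowP => k; rewrite !mxE /wrap1 mulrzDr. Qed.

Lemma absZ_leP (i : Zd d) (n : nat) :
  reflect (forall k, (`|i ord0 k| <= n)%N) (absZ i <= n)%N.
Proof.
by apply: (iffP (bigmax_leqP _ _ _)) => [h k|h k _]; exact: h.
Qed.

Lemma wrapK i : (absZ i <= m)%N -> unwrap (wrap i) = i.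
Proof.
by move=> /absZ_leP im; apply/rowP => k; rewrite !mxE wrap1K.
Qed.

Lemma unwrapK a : wrap (unwrap a) = a.
Proof. by apply/rowP => k; rewrite !mxE unwrap1K. Qed.

Lemma absZ_unwrap a : (absZ (unwrap a) <= m)%N.
Proof. by apply/absZ_leP => k; rewrite mxE unwrap1_bound. Qed.

Lemma unwrap_inj : injective unwrap.
Proof. exact: can_inj unwrapK. Qed.

Lemma box_unwrap : [set i : Zd d | (absZ i <= m)%N] = range unwrap.
Proof.
apply/seteqP; split => [i im|_ [a _ <-]]; last exact: absZ_unwrap.
by exists (wrap i) => //; rewrite wrapK.
Qed.

Lemma finite_box : finite_set [set i : Zd d | (absZ i <= m)%N].
Proof. by rewrite box_unwrap; apply: finite_image; exact: finite_finset. Qed.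

End Torus.

Lemma absZD d (i j : Zd d) : (absZ (i + j) <= absZ i + absZ j)%N.
Proof.
apply/absZ_leP => k; rewrite mxE.
have /absZ_leP/(_ k) ik := leqnn (absZ i).
have /absZ_leP/(_ k) jk := leqnn (absZ j).
by apply: leq_trans (leq_add ik jk); move: (i _ _) (j _ _) => a b; lia.
Qed.

Lemma absZN d (i : Zd d) : absZ (- i) = absZ i.
Proof. by apply: eq_bigr => k _; rewrite mxE abszN. Qed.

Lemma finite_Zd_bounded d (S : set (Zd d)) : finite_set S <->
  exists m, forall i, S i -> (absZ i <= m)%N.
Proof.
split=> [fS|[m Sm]]; last exact: sub_finite_set (finite_box d m).
exists (\max_(i <- fset_set S) absZ i)%N => i Si.
by apply: leq_bigmax_seq => //; rewrite in_fset_set// inE.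
Qed.

(** * Measurability on the space of fields *)

Section Fields.
Context (R : realType) (d : nat).
Implicit Types (x : Zdfield R d) (i k : Zd d).

Lemma measurable_coord i : measurable_fun setT (fun x => x i).
Proof.
move=> _ B mB; rewrite setTI; apply: sub_sigma_algebra.
by exists i, B.
Qed.

Lemma measurable_field (dT : measure_display) (T : measurableType dT)
    (f : T -> Zdfield R d) :
  (forall i, measurable_fun setT (fun t => f t i)) -> measurable_fun setT f.
Proof.
move=> mf.
apply: (@measurability _ _ _ (Zdfield R d) setT f (@coordinate_sets R d)) => //.
move=> _ [_ [i [B [mB ->]]] <-].
rewrite -[X in measurable X]/(setT `&` (fun t => f t i) @^-1` B).
exact: mf.
Qed.

Lemma measurable_fscale (dT : measure_display) (T : measurableType dT)
    (a : T -> R) (f : T -> Zdfield R d) :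
  measurable_fun setT a -> measurable_fun setT f ->
  measurable_fun setT (fun t => fscale (a t) (f t)).
Proof.
move=> ma mf; apply: measurable_field => i.
apply: measurable_funM => //.
exact: (measurableT_comp (measurable_coord i) mf).
Qed.

Lemma measurable_fshift k : measurable_fun setT (@fshift R d k).
Proof. by apply: measurable_field => i; exact: measurable_coord. Qed.

Lemma measurable_coord_gt i (a : R) : measurable [set x : Zdfield R d | a < `|x i|].
Proof.
have mi : measurable_fun setT (fun x : Zdfield R d => `|x i|).
  by apply: measurableT_comp => //; exact: measurable_coord.
by have := measurable_fun_ltr (measurable_cst a) mi; rewrite /= => /(_ measurableT [set true] I); rewrite setTI.
Qed.

Lemma measurable_coord_lt i (a : R) : measurable [set x : Zdfield R d | `|x i| < a].
Proof.
have mi : measurable_fun setT (fun x : Zdfield R d => `|x i|).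
  by apply: measurableT_comp => //; exact: measurable_coord.
by have := measurable_fun_ltr mi (measurable_cst a); rewrite /= => /(_ measurableT [set true] I); rewrite setTI.
Qed.

Lemma measurable_l0 : measurable (@l0 R d).
Proof.
rewrite (_ : @l0 R d = \bigcap_n \bigcup_m \bigcap_i
    [set x | (m <= absZ i)%N -> `|x i| < n.+1%:R^-1]); last first.
  apply/seteqP; split => x.
    move=> lx n _; have [|m xm] := lx n.+1%:R^-1; first by rewrite invr_gt0.
    by exists m => // i _; exact: xm.
  move=> h e e0; have [n en] : exists n, n.+1%:R^-1 < e.
    have := near_infty_natSinv_lt (PosNum e0).
    by case => n _ /(_ n (leqnn _)) /=; exists n.
  have [m _ xm] := h n I; exists m => i mi.
  exact: lt_trans (xm i I mi) en.
apply: bigcapT_measurable => n; apply: bigcupT_measurable => m.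
apply: measurable_bigcap_countable => i.
case: (leqP m (absZ i)) => im.
  rewrite (_ : mkset _ = [set x | `|x i| < n.+1%:R^-1]); first exact: measurable_coord_lt.
  by apply/seteqP; split => x /=; [exact|].
by rewrite (_ : mkset _ = setT)//; apply/seteqP; split => x.
Qed.

Lemma measurable_finite_exceed : measurable [set x : Zdfield R d | finite_set (exceed x)].
Proof.
rewrite (_ : mkset _ = \bigcup_m \bigcap_i
    [set x : Zdfield R d | 1 < `|x i| -> (absZ i <= m)%N]); last first.
  apply/seteqP; split => x.
    by move=> /finite_Zd_bounded[m xm]; exists m => // i _; exact: xm.
  by move=> [m _ h]; apply/finite_Zd_bounded; exists m => i; exact: (h i I).
apply: bigcupT_measurable => m.
apply: measurable_bigcap_countable => i.
case: (leqP (absZ i) m) => im.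
  by rewrite (_ : mkset _ = setT)//; apply/seteqP; split => x.
rewrite (_ : mkset _ = ~` [set x | 1 < `|x i|]).
  by apply: measurableC; exact: measurable_coord_gt.
by apply/seteqP; split => x /= h /h //; rewrite leqNgt im.
Qed.

Lemma measurable_E0 : measurable (@E0 R d).
Proof.
by apply: measurableI; [exact: measurable_coord_gt|exact: measurable_finite_exceed].
Qed.

Lemma fshiftD j k x : fshift j (fshift k x) = fshift (j + k) x.
Proof. by apply/funext => i; rewrite /fshift addrA. Qed.

Lemma fscaleA a b x : fscale a (fscale b x) = fscale (a * b) x.
Proof. by apply/funext => i; rewrite /fscale mulrA. Qed.

Lemma fscale1 x : fscale 1 x = x.
Proof. by apply/funext => i; rewrite /fscale mul1r. Qed.

Lemma l0_fshift k x : l0 x -> l0 (fshift k x).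
Proof.
move=> lx e e0; have [n xn] := lx e e0.
exists (n + absZ k)%N => i ni; apply: xn.
have := absZD (i + k) (- k); rewrite addrK absZN => h.
by rewrite -(leq_add2r (absZ k)) (leq_trans ni).
Qed.

Lemma l0_fscale a x : l0 x -> l0 (fscale a x).
Proof.
move=> lx e e0; have [n xn] := lx (e / (1 + `|a|)) ltac:(by rewrite divr_gt0// ltr_wpDr).
exists n => i ni; rewrite /fscale normrM.
have := xn i ni; rewrite ltr_pdivlMr ?ltr_wpDr//.
apply: le_lt_trans; rewrite mulrC ler_wpM2l// ler_wpDl//.
Qed.

(** In [l0] every level is exceeded finitely often only. *)
Lemma l0_finite_gt (a : R) x : 0 < a -> l0 x -> finite_set [set i | a < `|x i|].
Proof.
move=> a0 /(_ a a0)[n xn]; apply/finite_Zd_bounded; exists n => i /= ai.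
by rewrite leqNgt; apply/negP => /ltnW /xn; rewrite ltNge (ltW ai).
Qed.

Lemma l0_has_sup x : l0 x -> has_sup [set `|x i| | i in [set: Zd d]].
Proof.
move=> lx; split; first by exists `|x 0|, 0.
have [n xn] := lx 1 ltr01.
have fB := finite_box d n.
exists (1 + \sum_(i <- fset_set [set i : Zd d | (absZ i <= n)%N]) `|x i|) => _ [i _ <-].
have [ni|/ltnW/xn xi1] := leqP (absZ i) n; last first.
  by rewrite ltW// (lt_le_trans xi1)// lerDl sumr_ge0.
rewrite ler_wpDl// (big_fsetD1 i) ?in_fset_set ?inE//=.
by rewrite lerDl sumr_ge0.
Qed.

Lemma le_fnorm x i : l0 x -> `|x i| <= fnorm x.
Proof.
move=> /l0_has_sup[_ ub]; apply: ub_le_sup => //.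
Qed.

Lemma fnorm_ge0 x : l0 x -> 0 <= fnorm x.
Proof. by move=> lx; exact: le_trans (le_fnorm 0 lx). Qed.

Lemma fnorm_gtP x (a : R) : l0 x -> (a < fnorm x <-> exists i, a < `|x i|).
Proof.
move=> lx; split => [|[i ai]]; last exact: lt_le_trans ai (le_fnorm i lx).
by move=> /(sup_gt (l0_has_sup lx).1)[_ [i _ <-] ai]; exists i.
Qed.

Lemma fnorm_fshift k x : fnorm (fshift k x) = fnorm x.
Proof.
congr sup; apply/seteqP; split => [_ [i _ <-]|_ [i _ <-]].
  by exists (i + k).
by exists (i - k) => //; rewrite /fshift subrK.
Qed.

Lemma fnorm_fscale a x : l0 x -> fnorm (fscale a x) = `|a| * fnorm x.
Proof.
move=> lx; have [->|a0] := eqVneq a 0.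
  rewrite normr0 mul0r /fnorm (_ : [set _ | _ in _] = [set 0]) ?sup1//.
  apply/seteqP; split => [_ [i _ <-]|_ ->] /=; first by rewrite /fscale mul0r normr0.
  by exists 0 => //; rewrite /fscale mul0r normr0.
have la := l0_fscale a lx.
have na : 0 < `|a| by rewrite normr_gt0.
apply/eqP; rewrite eq_le; apply/andP; split; rewrite leNgt; apply/negP.
  move=> /(fnorm_gtP _ la)[i]; rewrite /fscale normrM ltr_pM2l//.
  by rewrite ltNge le_fnorm.
rewrite mulrC -ltr_pdivrMr// => /(fnorm_gtP _ lx)[i].
rewrite ltr_pdivrMr// mulrC => h.
by move: (le_fnorm i la); rewrite /fscale normrM leNgt h.
Qed.

Lemma measurable_fnorm (dT : measure_display) (T : measurableType dT)
    (f : T -> Zdfield R d) : measurable_fun setT f -> (forall t, l0 (f t)) ->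
  measurable_fun setT (fun t => fnorm (f t)).
Proof.
move=> mf lf; apply: (measurability _ (RGenOInfty.measurableE R)).
move=> _ [_ [a ->] <-]; rewrite setTI.
rewrite (_ : _ @^-1` _ = \bigcup_i (f @^-1` [set x | a < `|x i|])); last first.
  apply/seteqP; split => t /=.
    by rewrite in_itv/= andbT => /(fnorm_gtP _ (lf t))[i ai]; exists i.
  by move=> [i _ ai]; rewrite in_itv/= andbT; apply/(fnorm_gtP _ (lf t)); exists i.
apply: measurable_bigcup_countable => i; rewrite -[X in measurable X]setTI.
by apply: mf => //; exact: measurable_coord_gt.
Qed.

End Fields.

(** * Pareto mixtures of clusters *)

Section ImageMeasure.
Context (d1 d2 : measure_display) (T1 : measurableType d1)
  (T2 : measurableType d2) (R : realType).
Variables (mu : {measure set T1 -> \bar R}) (f : T1 -> T2).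
Hypothesis mf : measurable_fun setT f.

Definition image_measure : {measure set T2 -> \bar R} :=
  measure_function_pushforward__canonical__measure_function_Measure mu mf.

Lemma integral_image (g : T2 -> \bar R) : measurable_fun setT g ->
  (forall y, 0 <= g y)%E ->
  (\int[image_measure]_y g y = \int[mu]_x g (f x))%E.
Proof. by move=> mg g0; rewrite [LHS]ge0_integral_pushforward. Qed.

End ImageMeasure.

Section LebesgueScaling.
Context (R : realType).
Local Open Scope ereal_scope.
Local Notation leb := (@lebesgue_measure R).

Lemma integral_lebesgue_scale (a : R) (f : R -> \bar R) : (0 < a)%R ->
  measurable_fun setT f -> (forall r, 0 <= f r) ->
  a%:E * \int[leb]_r f (a * r)%R = \int[leb]_r f r.
Proof.
move=> a0 mf f0.
have ma : measurable_fun setT (fun r : measurableTypeR R => (a * r)%R : measurableTypeR R).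
  exact: measurable_funM.
pose nu := mscale (NngNum (ltW a0)) (image_measure leb ma).
rewrite [RHS](eq_measure_integral nu); last first.
  move=> A mA _; apply: lebesgue_measure_unique => // _ [[x y]] _ <-.
  rewrite -[RHS]/(a%:E * leb (( *%R a) @^-1` `]x, y])).
  rewrite (_ : _ @^-1` _ = `](x / a)%R, (y / a)%R]%classic); last first.
    apply/seteqP; split => r /=; rewrite !in_itv/=.
      by rewrite ltr_pdivrMr// ler_pdivlMr// ![(r * a)%R]mulrC.
    by rewrite ltr_pdivrMr// ler_pdivlMr// ![(r * a)%R]mulrC.
  rewrite !lebesgue_measure_itv/= !lte_fin ltr_pM2r ?invr_gt0//.
  case: ifPn => _; last by rewrite mule0.
  rewrite -!EFinB -EFinM; congr EFin; field; exact: lt0r_neq0.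
by rewrite /nu ge0_integral_mscale//= integral_image.
Qed.

End LebesgueScaling.

Section PowerLaw.
Context (R : realType) (alpha : R) (alpha_gt0 : 0 < alpha).

(** The quantile transform: for [r] uniform on the unit interval, [pareto r] has
    the Pareto distribution of index [alpha]. *)
Definition pareto (r : R) : R := r `^ (- alpha^-1).

Lemma pareto_gt0 r : 0 < r -> 0 < pareto r.
Proof. exact: powR_gt0. Qed.

Lemma pareto_scale r b : 0 < r -> 0 < b ->
  pareto (b `^ alpha * r) = pareto r / b.
Proof.
move=> r0 b0; rewrite /pareto powRM ?powR_ge0 ?ltW//.
rewrite -powRrM mulrN divff ?lt0r_neq0// mulrC; congr (_ * _).
by rewrite powR_inv1// ltW.
Qed.

Lemma ltr_powR_mono (p a b : R) : 0 < p -> 0 <= a -> 0 <= b ->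
  (a `^ p < b `^ p) = (a < b).
Proof.
move=> p0 a0 b0; apply/idP/idP; last exact: gt0_ltr_powR.
by rewrite !ltNge; apply: contra; exact: ge0_ler_powR (ltW p0) _ _ _ _.
Qed.

Lemma pareto_gt r b : 0 < r -> 0 < b -> (b < pareto r) = (r < b `^ (- alpha)).
Proof.
move=> r0 b0; rewrite -(ltr_powR_mono alpha_gt0) ?ltW ?pareto_gt0//.
rewrite /pareto -powRrM mulNr mulVf ?lt0r_neq0// powR_inv1 ?(ltW r0)//.
by rewrite powRN -[X in _ = (X < _)]invrK ltf_pV2// posrE ?invr_gt0 ?powR_gt0.
Qed.

Lemma pareto_gt1 r b : 0 < r -> 0 <= b -> (1 < pareto r * b) = (r < b `^ alpha).
Proof.
move=> r0 b0; move: b0; rewrite le_eqVlt => /predU1P[<-|b0].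
  by rewrite mulr0 powR0 ?lt0r_neq0// ltr10 ltNge (ltW r0).
rewrite -ltr_pdivrMr// mul1r pareto_gt ?invr_gt0//.
by rewrite -powR_inv1 ?ltW// -powRrM mulN1r opprK.
Qed.

Lemma measurable_pareto : measurable_fun setT pareto.
Proof. exact: measurable_powR. Qed.

End PowerLaw.

Section MeasurableIf.
Context (R : realType) (dT : measure_display) (T : measurableType dT).

Lemma measurable_ltr (f g : T -> R) :
  measurable_fun setT f -> measurable_fun setT g ->
  measurable [set t | f t < g t].
Proof.
move=> mf mg; have := measurable_fun_ltr mf mg => /(_ measurableT [set true] I).
by rewrite setTI.
Qed.

Lemma measurable_fun_if0 (dS : measure_display) (S : measurableType dS)
    (b : T -> bool) (f : T -> S) (s : S) :
  measurable [set t | b t] -> measurable_fun setT f ->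
  measurable_fun setT (fun t => if b t then f t else s).
Proof.
move=> mb mf; apply: measurable_fun_ifT => //.
by apply: (measurable_fun_bool true); rewrite setTI.
Qed.

Lemma measurable_funV_ge0 (f : T -> R) : measurable_fun setT f ->
  (forall t, 0 <= f t) -> measurable_fun setT (fun t => (f t)^-1).
Proof.
move=> mf f0; rewrite (_ : (fun t => _) = (powR (R:=R))^~ (-1) \o f).
  exact: measurableT_comp (measurable_powR _) mf.
by apply/funext => t /=; rewrite powR_inv1.
Qed.

End MeasurableIf.

Section Mixture.
Context (R : realType) (d : nat).
Context (dO : measure_display) (O : measurableType dO) (P : probability O R).
Context (C : O -> Zdfield R d) (kappa : O -> R) (alpha c : R).
Hypothesis C_l0 : random_element_l0 C.
Hypothesis alpha_gt0 : 0 < alpha.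
Hypothesis c_gt0 : 0 < c.
Hypothesis kappa_meas : measurable_fun setT kappa.
Local Notation leb := (@lebesgue_measure R).
Local Notation V := (pareto alpha).

(** The cluster [kappa C], scaled by [pareto r] and seen from site [k]. *)
Definition cluster (r : R) (w : O) (k : Zd d) : Zdfield R d :=
  fscale (V r * kappa w) (fshift k (C w)).

(** When [|kappa| = 1], the constraint says that the cluster exceeds 1 at its
    origin. *)
Definition ray_term (g : Zdfield R d -> R) (k : Zd d) (z : O * R) : R :=
  if (0 < z.2) && (z.2 < `|C z.1 k| `^ alpha) then g (cluster z.2 z.1 k) else 0.

Definition ray_sum (g : Zdfield R d -> R) (z : O * R) : \bar R :=
  (\esum_(k in [set: Zd d]) (ray_term g k z)%:E)%E.

Lemma measurable_absC k : measurable_fun setT (fun w => `|C w k|).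
Proof.
apply: measurableT_comp => //.
exact: (measurableT_comp (measurable_coord k) C_l0.1).
Qed.

Lemma measurable_absC_powR k : measurable_fun setT (fun w => `|C w k| `^ alpha).
Proof. exact: (measurableT_comp (measurable_powR alpha) (measurable_absC k)). Qed.

Lemma measurable_cluster k : measurable_fun setT (fun z : O * R => cluster z.2 z.1 k).
Proof.
apply: measurable_fscale.
  apply: measurable_funM.
    exact: (measurableT_comp (measurable_pareto alpha) measurable_snd).
  exact: (measurableT_comp kappa_meas measurable_fst).
apply: (measurableT_comp (measurable_fshift k)).
exact: (measurableT_comp C_l0.1 measurable_fst).
Qed.

Lemma measurable_ray_dom k :
  measurable [set z : O * R | (0 < z.2) && (z.2 < `|C z.1 k| `^ alpha)].
Proof.
rewrite (_ : mkset _ = [set z | 0 < z.2] `&` [set z | z.2 < `|C z.1 k| `^ alpha]).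
  apply: measurableI; apply: measurable_ltr => //.
  exact: (measurableT_comp (measurable_absC_powR k) measurable_fst).
by apply/seteqP; split => z /= => [/andP//|[-> ->]].
Qed.

Lemma measurable_ray_term g k : measurable_fun setT g ->
  measurable_fun setT (ray_term g k).
Proof.
move=> mg; apply: measurable_fun_if0; first exact: measurable_ray_dom.
exact: (measurableT_comp mg (measurable_cluster k)).
Qed.

Lemma ray_term_ge0 (g : Zdfield R d -> R) k z : (forall x, 0 <= g x) -> 0 <= ray_term g k z.
Proof. by move=> g0; rewrite /ray_term; case: ifP. Qed.

Lemma measurable_ray_sum (g : Zdfield R d -> R) : measurable_fun setT g -> (forall x, 0 <= g x) ->
  measurable_fun setT (ray_sum g).
Proof.
move=> mg g0; apply: measurable_esum => [k|k z].
  by apply/measurable_EFinP; exact: measurable_ray_term.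
by rewrite lee_fin ray_term_ge0.
Qed.

Lemma ray_sum_ge0 (g : Zdfield R d -> R) z : (forall x, 0 <= g x) -> (0 <= ray_sum g z)%E.
Proof. by move=> g0; apply: esum_ge0 => k _; rewrite lee_fin ray_term_ge0. Qed.

Let scaled_term (g : Zdfield R d -> R) (k : Zd d) (z : O * R) : R :=
  if [&& 0 < z.2, z.2 < 1 & C z.1 k != 0] then
    g (fscale (V z.2) (fscale (kappa z.1 / `|C z.1 k|) (fshift k (C z.1))))
      * `|C z.1 k| `^ alpha
  else 0.

Let measurable_scaled_term g k : measurable_fun setT g ->
  measurable_fun setT (scaled_term g k).
Proof.
move=> mg; have mC := measurableT_comp (measurable_absC k) (@measurable_fst _ _ O (measurableTypeR R)).
apply: measurable_fun_if0.
  rewrite (_ : mkset _ = [set z | 0 < z.2] `&` [set z | z.2 < 1] `&`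
      [set z | 0 < `|C z.1 k|]).
    by apply: measurableI; first apply: measurableI; exact: measurable_ltr.
  apply/seteqP; split => z /=; rewrite normr_gt0; first by case/and3P.
  by case=> -[-> ->] ->.
apply: measurable_funM; last exact: (measurableT_comp (measurable_powR alpha) mC).
apply: (measurableT_comp mg); apply: measurable_fscale.
  exact: (measurableT_comp (measurable_pareto alpha) measurable_snd).
apply: measurable_fscale.
  apply: measurable_funM; first exact: (measurableT_comp kappa_meas measurable_fst).
  exact: measurable_funV_ge0.
apply: (measurableT_comp (measurable_fshift k)).
exact: (measurableT_comp C_l0.1 measurable_fst).
Qed.

Let scaled_term_ge0 (g : Zdfield R d -> R) k z : (forall x, 0 <= g x) ->
  0 <= scaled_term g k z.
Proof. by move=> g0; rewrite /scaled_term; case: ifP => // _; rewrite mulr_ge0 ?powR_ge0. Qed.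

(** Rescaling the radius by [|C_k|^alpha] trades the weight of the [k]th cluster
    for the range of its radius. *)
Let integral_scaled_term (g : Zdfield R d -> R) k w : measurable_fun setT g ->
  (forall x, 0 <= g x) ->
  (\int[leb]_r (scaled_term g k (w, r))%:E =
   \int[leb]_r (ray_term g k (w, r))%:E)%E.
Proof.
move=> mg g0; have [Ck0|Ck0] := eqVneq (C w k) 0.
  apply: eq_integral => r _; rewrite /scaled_term /ray_term/= Ck0 eqxx !andbF.
  rewrite normr0 powR0 ?lt0r_neq0//; case: ifP => // /andP[r0 /(lt_trans r0)].
  by rewrite ltxx.
have nC : 0 < `|C w k| by rewrite normr_gt0.
have a0 : 0 < `|C w k| `^ alpha by rewrite powR_gt0.
have mf : measurable_fun setT (fun r : R => (ray_term g k (w, r))%:E).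
  apply/measurable_EFinP; apply: (measurableT_comp (measurable_ray_term k mg)).
  exact: pair1_measurable.
rewrite -(integral_lebesgue_scale a0 mf); last by move=> r; rewrite lee_fin ray_term_ge0.
rewrite -ge0_integralZl_EFin//; last 2 first.
- by move=> r _; rewrite lee_fin ray_term_ge0.
- by apply: (measurableT_comp mf); exact: measurable_funM.
apply: eq_integral => r _; rewrite -EFinM; congr EFin.
rewrite /scaled_term /ray_term /= Ck0 andbT pmulr_rgt0// gtr_pMr//.
case: ifP => [/andP[r0 r1]|_]; last by rewrite mulr0.
rewrite mulrC; congr (_ * g _); rewrite /cluster fscaleA pareto_scale//.
by congr (fscale _ _); rewrite mulrA mulrAC.
Qed.

(** For a fixed radius the mixture property is applied to [g] composed with the
    scaling; Tonelli's theorem then allows the radius to be rescaled separately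
    in each summand. *)
Lemma pareto_mixture (dT : measure_display) (OT : measurableType dT)
    (PT : probability OT R) (Theta : OT -> Zdfield R d) (g : Zdfield R d -> R) :
  random_element_l0 Theta ->
  mixture_representation P C kappa alpha c PT Theta ->
  measurable_fun setT g -> (forall x, 0 <= g x) ->
  (\int[leb]_(r in `]0%R, 1%R[) \int[PT]_t (g (fscale (V r) (Theta t)))%:E =
   (c^-1)%:E * \int[P \x leb]_z ray_sum g z)%E.
Proof.
move=> Theta_l0 mix mg g0.
have c0 : 0 <= c^-1 by rewrite invr_ge0 ltW.
pose S (z : O * R) := (\esum_(k in [set: Zd d]) (scaled_term g k z)%:E)%E.
have mS : measurable_fun setT S.
  apply: measurable_esum => [k|k z]; last by rewrite lee_fin scaled_term_ge0.
  by apply/measurable_EFinP; exact: measurable_scaled_term.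
have S0 z : (0 <= S z)%E by apply: esum_ge0 => k _; rewrite lee_fin scaled_term_ge0.
transitivity ((c^-1)%:E * \int[P \x leb]_z S z)%E.
  rewrite fubini_tonelli2// -ge0_integralZl_EFin//; last 2 first.
  - by move=> r _; exact: integral_ge0.
  - exact: measurable_fun_fubini_tonelli_G.
  rewrite [LHS]integral_mkcond; apply: eq_integral => r _.
  rewrite patchE; case: ifPn => [|/negP r01].
    rewrite inE/= in_itv/= => /andP[r0 r1].
    have := mix (fun x => g (fscale (V r) x)); rewrite unlock => ->; last first.
      split=> [|x _ //]; apply: measurable_funTS; apply: (measurableT_comp mg).
      exact: (measurable_fscale (measurable_cst (V r)) (@measurable_id _ _ _)).
    congr (_ * _)%E; apply: eq_integral => w _; apply: eq_esum => k _.
    congr EFin; rewrite /scaled_term /= r0 r1 /=.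
    by case: eqP.
  rewrite /fubini_G integral0_eq ?mule0// => w _.
  rewrite /S esum1// => k _; rewrite /scaled_term/=; case: ifP => // /and3P[r0 r1 _].
  by exfalso; apply: r01; rewrite inE/= in_itv/= r0.
have mr := measurable_ray_sum mg g0.
rewrite (@fubini_tonelli1 _ _ _ _ _ P leb S mS S0).
rewrite (@fubini_tonelli1 _ _ _ _ _ P leb (ray_sum g) mr
  (fun z => ray_sum_ge0 z g0)).
apply: (congr1 (mule _)); apply: eq_integral => w _.
rewrite /fubini_F /S /ray_sum.
rewrite !integral_esum.
- by apply: eq_esum => k _; exact: integral_scaled_term.
- move=> k; apply/measurable_EFinP.
  apply: (measurableT_comp (measurable_ray_term k mg)); exact: pair1_measurable.
- by move=> k r; rewrite lee_fin ray_term_ge0.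
- move=> k; apply/measurable_EFinP.
  apply: (measurableT_comp (measurable_scaled_term k mg)); exact: pair1_measurable.
- by move=> k r; rewrite lee_fin scaled_term_ge0.
Qed.

End Mixture.

(** * The law of a tail process *)

Section Ramp.
Context (R : realType).
Implicit Types (n : nat) (t : R).

(** Continuous approximation of the indicator of [0 < t], exact for all large
    [n]. *)
Definition ramp n t : R := Num.min 1 (Num.max 0 (n%:R * t)).

Lemma ramp_ge0 n t : 0 <= ramp n t.
Proof. by rewrite /ramp le_min ler01 le_max lexx. Qed.

Lemma ramp_le1 n t : ramp n t <= 1.
Proof. by rewrite /ramp ge_min lexx. Qed.

Lemma ramp_eq0 n t : t <= 0 -> ramp n t = 0.
Proof.
move=> t0; rewrite /ramp max_l; last by rewrite mulr_ge0_le0.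
by rewrite min_r.
Qed.

Lemma ramp_near t : \forall n \near \oo, ramp n t = (0 < t)%R%:R.
Proof.
have [t0|t0] := ltP 0 t; last by apply: nearW => n; rewrite ramp_eq0.
near=> n; have nt : 1 <= n%:R * t.
  rewrite -ler_pdivrMr// div1r.
  by near: n; exact: nbhs_infty_ger.
by rewrite /ramp max_r ?(le_trans _ nt)// min_l.
Unshelve. all: by end_near. Qed.

Lemma ramp_continuous (T : topologicalType) n (f : T -> R) :
  continuous f -> continuous (fun x => ramp n (f x)).
Proof.
move=> cf x; apply: (@continuous_min R T (cst 1) (fun x => Num.max 0 (n%:R * f x))).
  exact: cvg_cst.
apply: (@continuous_max R T (cst 0) (fun x => n%:R * f x)); first exact: cvg_cst.
by apply: continuousM; [exact: cvg_cst|exact: cf].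
Qed.

Lemma measurable_ramp n : measurable_fun setT (ramp n).
Proof.
by apply: continuous_measurable_fun; apply: ramp_continuous => x; exact: cvg_id.
Qed.

End Ramp.

Section Bump.
Context (R : realType) (d : nat).
Implicit Types (x : Zdfield R d) (a : R) (L : seq (Zd d * R)) (n m : nat).

(** The product of the ramps of all constraints of [orthant a L]: below its
    indicator, and equal to it for all large [n]. *)
Definition bump a L n x : R :=
  (\prod_(p <- L) ramp n (a * x p.1 - p.2)) * ramp n (`|a * x 0| - 1).

Definition orthant a L : set (Zdfield R d) :=
  [set x | all (fun p => p.2 < a * x p.1) L && (1 < `|a * x 0|)].

Lemma bump_ge0 a L n x : 0 <= bump a L n x.
Proof. by rewrite mulr_ge0 ?ramp_ge0// prodr_ge0 // => p _; exact: ramp_ge0. Qed.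

Lemma bump_le1 a L n x : bump a L n x <= 1.
Proof.
rewrite mulr_ile1 ?ramp_ge0 ?ramp_le1//.
  by rewrite prodr_ge0 // => p _; exact: ramp_ge0.
by apply: prodr_ile1 => p _; rewrite ramp_ge0 ramp_le1.
Qed.

Lemma bump_fscale a b L n x : bump a L n (fscale b x) = bump (a * b) L n x.
Proof.
by rewrite /bump /fscale mulrA; congr (_ * _); apply: eq_bigr => p _; rewrite mulrA.
Qed.

Lemma bump_eq0 a L n x : `|a * x 0| <= 1 -> bump a L n x = 0.
Proof. by move=> x1; rewrite /bump [ramp _ (`|_| - _)]ramp_eq0 ?mulr0// subr_le0. Qed.

Lemma bump_near a L x : \forall n \near \oo, bump a L n x = \1_(orthant a L) x.
Proof.
have h : \forall n \near \oo,
    \prod_(p <- L) ramp n (a * x p.1 - p.2) = (all (fun p => p.2 < a * x p.1)%R L)%:R.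
  elim: L => [|p L IH]; first by apply: nearW => n; rewrite big_nil.
  apply: filterS2 IH (ramp_near (a * x p.1 - p.2)) => n IH E.
  by rewrite big_cons IH E subr_gt0 -natrM mulnb.
apply: filterS2 h (ramp_near (`|a * x 0| - 1)) => n h E.
rewrite /bump h E subr_gt0 -natrM mulnb indicE; congr ((nat_of_bool _)%:R).
by apply/idP/idP => [H|]; [rewrite mem_set|rewrite inE].
Qed.

Lemma continuous_bump (T : topologicalType) a L n (e : T -> Zdfield R d) :
  (forall i, continuous (fun y => e y i)) -> continuous (fun y => bump a L n (e y)).
Proof.
move=> ce; have cM i : continuous (fun y => a * e y i).
  by move=> y; apply: continuousM; [exact: cvg_cst|exact: ce].
have cB (f : T -> R) b : continuous f -> continuous (fun y => f y - b).
  by move=> cf y; apply: (@continuousB R R T f (cst b)); [exact: cf|exact: cvg_cst].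
have cN : continuous (fun y => `|a * e y 0|).
  by move=> y; apply: (@cvg_norm R R); exact: cM.
have cP : continuous (fun y => \prod_(p <- L) ramp n (a * e y p.1 - p.2)).
  apply: continuous_big => [|p _]; first exact: mul_continuous.
  by apply: ramp_continuous; apply: cB.
move=> y; apply: (@continuousM _ _ _ (fun y => ramp n (`|a * e y 0| - 1))).
  exact: cP.
by apply: ramp_continuous; exact: cB.
Qed.

Lemma measurable_bump a L n : measurable_fun setT (bump a L n).
Proof.
apply: measurable_funM.
  apply: measurable_prod => p _; apply: measurableT_comp; first exact: measurable_ramp.
  apply: measurable_funB => //; apply: measurable_funM => //.
  exact: measurable_coord.
apply: measurableT_comp; first exact: measurable_ramp.
apply: measurable_funB => //; apply: measurableT_comp => //.
by apply: measurable_funM => //; exact: measurable_coord.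
Qed.

Lemma measurable_orthant a L : measurable (orthant a L).
Proof.
have mc i : measurable_fun setT (fun x : Zdfield R d => a * x i).
  by apply: measurable_funM => //; exact: measurable_coord.
rewrite (_ : orthant a L = [set x | all (fun p => p.2 < a * x p.1) L] `&`
    [set x | 1 < `|a * x 0|]); last first.
  by apply/seteqP; split => x => [/andP//|[? ?]]; apply/andP.
apply: measurableI; last by apply: measurable_ltr => //; exact: measurableT_comp.
elim: L => [|p L IH] /=.
  by rewrite (_ : [set _ | _] = setT)//; apply/seteqP; split.
rewrite (_ : [set _ | _] = [set x | p.2 < a * x p.1] `&`
    [set x | all (fun p => p.2 < a * x p.1) L]).
  by apply: measurableI => //; exact: measurable_ltr.
by apply/seteqP; split => x /= => [/andP//|[-> ->]].
Qed.

(** Extension by 0 lets an observable of fields be evaluated on a box. *)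
Definition box_ext m (y : {ptws box d m -> R}) : Zdfield R d :=
  fun i => if pselect (absZ i <= m)%N is left h then y (exist _ i h) else 0.

Lemma box_ext_restr m x i : (absZ i <= m)%N -> box_ext (box_restr (m:=m) x) i = x i.
Proof. by move=> im; rewrite /box_ext; case: pselect. Qed.

Lemma box_ext_continuous m i : continuous (fun y => @box_ext m y i).
Proof.
have [h|h] := pselect (absZ i <= m)%N.
  rewrite (_ : (fun y => _) = @proj (box d m) (fun=> R) (exist _ i h)).
    exact: proj_continuous.
  apply/funext => y; rewrite /box_ext; case: pselect => // h'.
  by rewrite (bool_irrelevance h' h).
rewrite (_ : (fun y => _) = cst 0); first exact: cst_continuous.
by apply/funext => y; rewrite /box_ext; case: pselect.
Qed.

(** The observables whose limits define a tail process. *)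
Definition box_observable (g : Zdfield R d -> R) :=
  exists m (f : {ptws box d m -> R} -> R),
    [/\ continuous f, (exists M : R, forall y, `|f y| <= M) &
        forall x, f (box_restr x) = g x].

Lemma box_observable_bump a L n : box_observable (bump a L n).
Proof.
exists (\max_(p <- L) absZ p.1)%N.
exists (fun y => bump a L n (box_ext y)); split.
- by apply: continuous_bump => i; exact: box_ext_continuous.
- by exists 1 => y; rewrite ger0_norm ?bump_ge0 ?bump_le1.
move=> x; rewrite /bump box_ext_restr; last first.
  by rewrite (_ : absZ 0 = 0%N)// /absZ big1// => k _; rewrite mxE.
congr (_ * _); rewrite !big_seq; apply: eq_bigr => p pL; rewrite box_ext_restr//.
exact: (leq_bigmax_seq (F := fun p : Zd d * R => absZ p.1)).
Qed.

End Bump.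

Section OrthantSystem.
Context (R : realType) (d : nat).

Definition orthants : set (set (Zdfield R d)) :=
  [set B | exists L : seq (Zd d * R),
     B = [set x | all (fun p => p.2 < x p.1) L]].

Lemma measurable_orthants : @measurable _ (Zdfield R d) = <<s orthants >>.
Proof.
apply/seteqP; split.
  apply: smallest_sub; first exact: smallest_sigma_algebra.
  move=> _ [i [B [mB ->]]].
  have mi : measurable_fun setT (fun x : g_sigma_algebraType orthants => x i : R).
    apply: (measurability _ (RGenOInfty.measurableE R)).
    move=> _ [_ [a ->] <-]; rewrite setTI.
    apply: sub_sigma_algebra; exists [:: (i, a)].
    by apply/seteqP; split => x /=; rewrite in_itv/= !andbT.
  by have := mi measurableT B mB; rewrite setTI.
apply: smallest_sub; first exact: sigma_algebra_measurable.
move=> _ [L ->]; elim: L => [|p L IH] /=.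
  by rewrite (_ : [set _ | _] = setT)//; apply/seteqP; split.
rewrite (_ : [set _ | _] = [set x | p.2 < x p.1] `&`
    [set x | all (fun p => p.2 < x p.1) L]).
  by apply: measurableI => //; apply: measurable_ltr => //; exact: measurable_coord.
by apply/seteqP; split => x => [/andP//|[? ?]]; apply/andP.
Qed.

Lemma orthants_setI : setI_closed orthants.
Proof.
move=> _ _ [L ->] [L' ->]; exists (L ++ L').
by apply/seteqP; split => x /=; rewrite all_cat => /andP.
Qed.

Lemma field_measure_unique (m1 m2 : {measure set (Zdfield R d) -> \bar R}) :
  (forall L, m1 [set x | all (fun p => p.2 < x p.1) L] =
             m2 [set x | all (fun p => p.2 < x p.1) L]) ->
  (m1 setT < +oo)%E -> forall B, measurable B -> m1 B = m2 B.
Proof.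
move=> m12 m1oo B mB; apply: (measure_unique orthants (fun=> setT)) => //.
- exact: measurable_orthants.
- exact: orthants_setI.
- by move=> _; exists [::]; apply/seteqP; split.
- by rewrite bigcup_const//; exists 0%N.
- by move=> _ [L ->].
Qed.

End OrthantSystem.

Section TailLaw.
Context (R : realType) (d : nat).
Context (dX dY : measure_display) (OX : measurableType dX) (OY : measurableType dY).
Context (PX : probability OX R) (X : OX -> Zdfield R d).
Context (PY : probability OY R) (Y : OY -> Zdfield R d).
Hypothesis tailY : tail_process PX X PY Y.
Context (alpha : R).
Hypothesis tail_indexY : tail_index PY Y alpha.

Let mY : measurable_fun setT Y. Proof. by case: tailY. Qed.

Let tail_event (u : R) : set OX := [set w | u < `|X w 0|].

Let p (u : R) : R := fine (PX (tail_event u)).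

Let EY (g : Zdfield R d -> R) : R := \int[PY]_w g (Y w).

Let cvg_tail g : box_observable g ->
  (\int[PX]_(w in tail_event u) g (fscale u^-1 (X w))) / p u @[u --> +oo] --> EY g.
Proof.
move=> [m [f [cf bf fg]]]; have [_ _ _ /(_ m f cf bf)] := tailY.
by rewrite /EY; under eq_fun do under eq_Rintegral do rewrite fg;
  under [X in _ --> X -> _]eq_Rintegral do rewrite fg.
Qed.

(** An observable of [X / u] that vanishes unless [|X_0| > u y] may be
    integrated over either tail event. *)
Let tail_event_scale (y u : R) L n : 1 <= y -> 0 < u ->
  \int[PX]_(w in tail_event u) bump y^-1 L n (fscale u^-1 (X w)) =
  \int[PX]_(w in tail_event (u * y)) bump 1 L n (fscale (u * y)^-1 (X w)).
Proof.
move=> y1 u0; have y0 : 0 < y by exact: lt_le_trans y1.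
rewrite /Rintegral; congr fine; rewrite integral_mkcond [RHS]integral_mkcond.
apply: eq_integral => w _; rewrite !patchE.
rewrite !bump_fscale mul1r (_ : y^-1 / u = (u * y)^-1); last by rewrite invfM mulrC.
have [wu|wu] := ltP u `|X w 0|; have [wuy|wuy] := ltP (u * y) `|X w 0|.
- by rewrite !mem_set.
- rewrite mem_set// memNset; last by rewrite /tail_event/= ltNge wuy.
  have uy0 : 0 < u * y by rewrite mulr_gt0.
  rewrite bump_eq0// normrM [X in X * _]gtr0_norm ?invr_gt0//.
  by rewrite mulrC ler_pdivrMr// mul1r.
- exfalso; have := lt_le_trans wuy wu.
  by rewrite ltNge ler_peMr// ltW.
- by rewrite !memNset// /tail_event/= ltNge ?wuy ?wu.
Qed.

(** The limits along the levels [u] and [u y] share their numerators and differ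
    in the denominators [p u] and [p (u y)] only, which cancel in the products. *)
Let EY_cross (y : R) L L' n : 1 <= y ->
  EY (bump y^-1 L n) * EY (bump 1 L' n) = EY (bump y^-1 L' n) * EY (bump 1 L n).
Proof.
move=> y1; have y0 : 0 < y by exact: lt_le_trans y1.
pose N L0 u : R := \int[PX]_(w in tail_event (u * y)) bump 1 L0 n (fscale (u * y)^-1 (X w)).
have h1 L0 : N L0 u / p u @[u --> +oo] --> EY (bump y^-1 L0 n).
  apply: cvg_trans (cvg_tail (box_observable_bump y^-1 L0 n)).
  apply: near_eq_cvg; near=> u; rewrite tail_event_scale//.
have h2 L0 : N L0 u / p (u * y) @[u --> +oo] --> EY (bump 1 L0 n).
  have := cvg_tail (box_observable_bump 1 L0 n).
  apply: (@cvg_comp _ _ _ (fun u => u * y) _ _ _ _).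
  exact: gt0_cvgMly.
have e1 : (N L u / p u) * (N L' u / p (u * y)) @[u --> +oo] -->
    EY (bump y^-1 L n) * EY (bump 1 L' n) by exact: cvgM (h1 L) (h2 L').
have e2 : (N L' u / p u) * (N L u / p (u * y)) @[u --> +oo] -->
    EY (bump y^-1 L' n) * EY (bump 1 L n) by exact: cvgM (h1 L') (h2 L).
rewrite (_ : (fun u => _) = (fun u => N L u / p u * (N L' u / p (u * y)))) in e2.
  by rewrite -(cvg_lim (@Rhausdorff R) e1) -(cvg_lim (@Rhausdorff R) e2).
by apply/funext => u; rewrite mulrACA [RHS]mulrACA [N L u * _]mulrC.
Unshelve. all: by end_near. Qed.

Let EY_bump_cvg a L :
  EY (bump a L n) @[n --> \oo] --> fine (PY (Y @^-1` orthant a L)).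
Proof.
have mO : measurable (Y @^-1` orthant a L).
  by rewrite -[X in measurable X]setTI; apply: mY => //; exact: measurable_orthant.
have [] := @dominated_convergence _ _ _ PY setT measurableT
    (fun n w => (bump a L n (Y w))%:E) (fun w => (\1_(orthant a L) (Y w))%:E)
    (cst 1%E).
- move=> n; apply/measurable_EFinP.
  exact: (measurableT_comp (measurable_bump a L n) mY).
- apply/measurable_EFinP; apply: (measurableT_comp _ mY).
  by apply: measurable_indic; exact: measurable_orthant.
- apply: aeW => w _; apply: cvg_near_cst.
  by apply: filterS (bump_near a L (Y w)) => n ->.
- by apply: finite_measure_integrable_cst.
- apply: aeW => w n _.
  by rewrite /= lee_fin ger0_norm ?bump_ge0 ?bump_le1.
move=> _ _ h; rewrite /EY /Rintegral; apply: fine_cvg.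
rewrite fineK ?fin_num_measure//.
suff <- : (\int[PY]_w (\1_(orthant a L) (Y w))%:E = PY (Y @^-1` orthant a L))%E by [].
by rewrite -[in RHS](setIT (Y @^-1` _)) -integral_indic.
Qed.

Let measurable_Y B : measurable B -> measurable (Y @^-1` B).
Proof. by move=> mB; rewrite -[X in measurable X]setTI; exact: mY. Qed.

Let tail_orthant (y : R) L : 1 <= y ->
  PY (Y @^-1` orthant y^-1 L) =
  ((y `^ (- alpha))%:E * PY (Y @^-1` orthant 1 L))%E.
Proof.
move=> y1; have y0 : 0 < y by exact: lt_le_trans y1.
(* without constraints, the event is that |Y_0| exceeds the level *)
have c1 : EY (bump y^-1 L n) * EY (bump 1 [::] n) @[n --> \oo] -->
    fine (PY (Y @^-1` orthant y^-1 L)) * fine (PY (Y @^-1` orthant 1 [::])).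
  exact: cvgM (@EY_bump_cvg y^-1 L) (@EY_bump_cvg 1 [::]).
have c2 : EY (bump y^-1 [::] n) * EY (bump 1 L n) @[n --> \oo] -->
    fine (PY (Y @^-1` orthant y^-1 [::])) * fine (PY (Y @^-1` orthant 1 L)).
  exact: cvgM (@EY_bump_cvg y^-1 [::]) (@EY_bump_cvg 1 L).
have fk A : measurable A -> (fine (PY (Y @^-1` A)))%:E = PY (Y @^-1` A).
  by move=> mA; rewrite fineK// fin_num_measure//; exact: measurable_Y.
rewrite -(fk _ (measurable_orthant y^-1 L)) -(fk _ (measurable_orthant 1 L)).
rewrite -EFinM; congr EFin.
have E1 : PY (Y @^-1` orthant 1 [::]) = 1%E.
  have [_ <- _ _] := tailY; congr (PY _).
  by apply/seteqP; split => w; rewrite /orthant/= mul1r.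
have E2 : PY (Y @^-1` orthant y^-1 [::]) = (y `^ (- alpha))%:E.
  rewrite -tail_indexY//; congr (PY _); apply/seteqP; split => w;
  by rewrite /orthant/= normrM gtr0_norm ?invr_gt0// ltr_pdivlMl// mulr1.
move: c1 c2; rewrite E1 E2 [fine 1]/= [fine _%:E]/= mulr1 => c1 c2.
rewrite -(cvg_lim (@Rhausdorff R) c2); apply/esym/cvg_lim => //.
apply: cvg_trans c1; apply: near_eq_cvg; apply: nearW => n.
exact: EY_cross.
Qed.

(** Homogeneity of the tail process: conditioning on a higher level only
    rescales it. *)
Lemma tail_process_scaling (y : R) B : 1 <= y -> measurable B ->
  PY [set w | y < `|Y w 0| /\ B (fscale y^-1 (Y w))] =
  ((y `^ (- alpha))%:E * PY [set w | (1 < `|Y w 0%R|)%R /\ B (Y w)])%E.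
Proof.
move=> y1 mB; have y0 : 0 < y by exact: lt_le_trans y1.
have mE u : measurable [set w | u < `|Y w 0|].
  by apply: (measurable_Y (B := [set x | u < `|x 0|])); exact: measurable_coord_gt.
have msY : measurable_fun setT (fun w => fscale y^-1 (Y w)).
  exact: (measurable_fscale (measurable_cst _) mY).
pose m1 := image_measure (mrestr PY (mE y)) msY.
pose m2 := mscale (NngNum (powR_ge0 y (- alpha))) (image_measure (mrestr PY (mE 1)) mY).
have E B0 : PY [set w | y < `|Y w 0| /\ B0 (fscale y^-1 (Y w))] = m1 B0.
  by congr (PY _); apply/seteqP; split => w [].
rewrite E (_ : ((y `^ (- alpha))%:E * _)%E = m2 B); last first.
  by congr (_ * PY _)%E; apply/seteqP; split => w [].
apply: field_measure_unique => //; last first.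
  rewrite -E; apply: le_lt_trans (ltry 1); apply: probability_le1.
  rewrite (_ : [set _ | _] = [set w | y < `|Y w 0|])//.
  by apply/seteqP; split => w //= [].
have oE (a : R) L (x : Zdfield R d) : 0 < a -> orthant a^-1 L x <->
    a < `|x 0| /\ all (fun p => p.2 < fscale a^-1 x p.1) L.
  move=> a0; rewrite /orthant/= normrM gtr0_norm ?invr_gt0// ltr_pdivlMl// mulr1.
  by split => [/andP[]|[? ?]] //; apply/andP.
move=> L; rewrite -E; have := tail_orthant L y1; congr (_ = _).
  congr (PY _); apply/seteqP; split => w; first by move=> /(oE _ _ _ y0).
  by move=> h; apply/(oE _ _ _ y0).
congr (_ * PY _)%E; apply/seteqP; split => w.
  rewrite /preimage -[X in orthant X]invr1 => /(oE _ _ _ ltr01); rewrite invr1 fscale1.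
  by case.
rewrite /preimage -[X in orthant X]invr1 => -[? ?]; apply/(oE _ _ _ ltr01).
by rewrite invr1 fscale1.
Qed.

End TailLaw.

Section ParetoLaw.
Context (R : realType) (alpha : R) (alpha_gt0 : 0 < alpha).
Local Notation leb := (@lebesgue_measure R).
Local Notation U := (@uniform_prob R 0 1 ltr01).
Local Notation V := (pareto alpha).

Lemma integral_uniform01 (f : R -> \bar R) : measurable_fun setT f ->
  (forall r, 0 <= f r)%E ->
  (\int[U]_r f r = \int[leb]_(r in `]0%R, 1%R[) f r)%E.
Proof.
move=> mf f0; rewrite integral_uniform// subr0 invr1 mul1e integral_itv_bndoo//.
exact: measurable_funTS.
Qed.

Lemma uniform_pareto_gt (a : R) :
  U [set r | a < V r] = (if 1 <= a then a `^ (- alpha) else 1)%:E.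
Proof.
have mS : measurable [set r : R | a < V r].
  exact: measurable_ltr (measurable_cst a) (measurable_pareto alpha).
transitivity (\int[U]_r (\1_[set r | a < V r] r)%:E)%E.
  by rewrite integral_indic// setIT.
rewrite integral_uniform01; last 2 first.
- by apply/measurable_EFinP; exact: measurable_indic.
- by move=> r; rewrite lee_fin.
rewrite integral_indic//.
case: ifPn => a1.
  have a0 : 0 < a by exact: lt_le_trans a1.
  have b1 : a `^ (- alpha) <= 1.
    rewrite powRN invf_le1 ?powR_gt0//; have {1}<- : 1 `^ alpha = 1 :> R by rewrite powR1.
    by rewrite ge0_ler_powR ?nnegrE// ltW.
  rewrite (_ : _ `&` _ = `]0, a `^ (- alpha)[%classic).
    rewrite -[LHS]/(lebesgue_measure `]0, a `^ (- alpha)[%classic).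
    by rewrite lebesgue_measure_itv/= lte_fin powR_gt0// -EFinB subr0.
  apply/seteqP; split => r /=; rewrite !in_itv/=.
    by move=> [ar /andP[r0 _]]; rewrite r0 -pareto_gt.
  by move=> /andP[r0 rb]; rewrite r0 pareto_gt// (lt_le_trans rb).
rewrite (_ : _ `&` _ = `]0, 1[%classic).
  rewrite -[LHS]/(lebesgue_measure `]0, 1[%classic).
  by rewrite lebesgue_measure_itv/= lte_fin ltr01 -EFinB subr0.
apply/seteqP; split => r /=; rewrite !in_itv/=; first by case.
move=> /andP[r0 r1]; split; last by rewrite r0.
apply: (@lt_trans _ _ 1); first by rewrite ltNge.
by rewrite pareto_gt// powR1.
Qed.

End ParetoLaw.

Section Spectral.
Context (R : realType) (d : nat).

Lemma measurable_spectral : measurable_fun setT (@spectral R d).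
Proof.
apply: measurable_fscale; last exact: measurable_id.
apply: measurable_funV_ge0 => //; apply: measurableT_comp => //.
exact: measurable_coord.
Qed.

Lemma spectral_fscale (a : R) (y : Zdfield R d) : 0 < a ->
  spectral (fscale a y) = spectral y.
Proof.
move=> a0; rewrite /spectral fscaleA; congr fscale.
by rewrite /fscale normrM gtr0_norm// invfM mulrAC mulVf ?lt0r_neq0// mul1r.
Qed.

Lemma fscale_spectral (y : Zdfield R d) : y 0 != 0 ->
  fscale `|y 0| (spectral y) = y.
Proof. by move=> y0; rewrite /spectral fscaleA divff ?normr_eq0// fscale1. Qed.

End Spectral.

Lemma probability_setI_one (R : realType) (dT : measure_display)
    (T : measurableType dT) (P : probability T R) (A E : set T) :
  measurable A -> measurable E -> P E = 1%E -> P (E `&` A) = P A.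
Proof.
move=> mA mE E1; have mD : measurable (A `\` E) by exact: measurableD.
rewrite -[in RHS](setUIDK A E) measureU//; last 2 first.
- exact: measurableI.
- by apply/seteqP; split => // x [[_ ?] []].
rewrite setIC [X in (_ + X)%E](_ : _ = 0%E) ?adde0//.
apply/eqP; rewrite eq_le measure_ge0 andbT.
apply: (@le_trans _ _ (P (~` E))); last by rewrite probability_setC// E1 subee.
by apply: le_measure; rewrite ?inE//; exact: measurableC.
Qed.

Section Polar.
Context (R : realType) (d : nat).
Context (dX dY : measure_display) (OX : measurableType dX) (OY : measurableType dY).
Context (PX : probability OX R) (X : OX -> Zdfield R d).
Context (PY : probability OY R) (Y : OY -> Zdfield R d).
Hypothesis tailY : tail_process PX X PY Y.
Context (alpha : R) (alpha_gt0 : 0 < alpha).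
Hypothesis tail_indexY : tail_index PY Y alpha.
Local Notation leb := (@lebesgue_measure R).
Local Notation U := (@uniform_prob R 0 1 ltr01).
Local Notation V := (pareto alpha).

Let mY : measurable_fun setT Y. Proof. by case: tailY. Qed.

Let mY0 : measurable_fun setT (fun w => `|Y w 0|).
Proof.
by apply: measurableT_comp => //; exact: (measurableT_comp (measurable_coord 0) mY).
Qed.

Let mSY : measurable_fun setT (fun w => spectral (Y w)).
Proof. exact: (measurableT_comp (@measurable_spectral R d) mY). Qed.

Let Y0_gt1 : PY [set w | 1 < `|Y w 0|] = 1%E. Proof. by case: tailY. Qed.

Let mgt (u : R) : measurable [set w | u < `|Y w 0|].
Proof. exact: measurable_ltr (measurable_cst u) mY0. Qed.

Let polar_ray (a : R) B : measurable B ->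
  PY [set w | a < `|Y w 0| /\ B (spectral (Y w))] =
  ((if 1 <= a then a `^ (- alpha) else 1)%R%:E * PY [set w | B (spectral (Y w))])%E.
Proof.
move=> mB; have mBs : measurable [set w | B (spectral (Y w))].
  by have := mSY measurableT mB; rewrite setTI.
have E1 : PY [set w | 1 < `|Y w 0| /\ B (spectral (Y w))] = PY [set w | B (spectral (Y w))].
  rewrite -[RHS](@probability_setI_one _ _ _ PY _ _ mBs (mgt 1) Y0_gt1).
  by congr (PY _).
case: ifPn => a1; last first.
  rewrite mul1e -E1; rewrite -[LHS](@probability_setI_one _ _ _ PY _ _ _ (mgt 1) Y0_gt1).
    congr (PY _); apply/seteqP; split => w /= [].
      by move=> ? [].
    move=> w1 ?; split=> //; split=> //; apply: lt_trans w1.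
    by rewrite ltNge.
  exact: measurableI (mgt a) mBs.
have a0 : 0 < a by exact: lt_le_trans a1.
rewrite -E1.
rewrite -(tail_process_scaling tailY tail_indexY (B := @spectral R d @^-1` B) a1)//.
  by congr (PY _); apply/seteqP; split => w /=; rewrite spectral_fscale ?invr_gt0.
by rewrite -[X in measurable X]setTI; exact: measurable_spectral.
Qed.

(** The spectral part does not see scaling, so homogeneity gives the joint
    probabilities [polar_ray] a product form: the modulus [|Y_0|] is independent
    of the spectral part. *)
Lemma tail_process_polar (g : Zdfield R d -> R) :
  measurable_fun setT g -> (forall x, 0 <= g x) ->
  (\int[PY]_w (g (Y w))%:E =
   \int[leb]_(r in `]0%R, 1%R[) \int[PY]_w (g (fscale (V r) (spectral (Y w))))%:E)%E.
Proof.
move=> mg g0.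
have mJ : measurable_fun setT (fun w => (`|Y w 0| : R, spectral (Y w))).
  exact: measurable_fun_pair.
pose J := image_measure PY mJ.
have mV : measurable_fun setT (V : measurableTypeR R -> R).
  exact: measurable_pareto.
pose m1 := distribution U (@mfun_Sub _ _ (measurableTypeR R) R _ (mem_set mV)).
pose m2 := distribution PY (mfun_Sub (mem_set mSY)).
(* for fixed [B] both sides are finite measures of [A], determined by rays *)
have JE A B : measurable A -> measurable B -> J (A `*` B) = (m1 A * m2 B)%E.
  move=> mA mB.
  have mBs : measurable [set w | B (spectral (Y w))].
    by have := mSY measurableT mB; rewrite setTI.
  pose q : R := fine (PY [set w | B (spectral (Y w))]).
  have q0 : 0 <= q by rewrite fine_ge0.
  have qE : PY [set w | B (spectral (Y w))] = q%:E by rewrite fineK// fin_num_measure.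
  pose n1 := image_measure (mrestr PY mBs) mY0.
  pose n2 := mscale (NngNum q0) m1.
  rewrite (_ : J _ = n1 A)// (_ : (_ * _)%E = n2 A); last by rewrite muleC -[m2 B]/(PY _) qE.
  apply: (measure_unique (@RGenOInfty.G R) (fun n => `](- n%:R), +oo[%classic)) => //.
  - exact: RGenOInfty.measurableE.
  - move=> _ _ [a ->] [b ->]; exists (Num.max a b).
    by apply/seteqP; split => x /=; rewrite !in_itv/= !andbT gt_max => /andP.
  - by move=> n; exists (- n%:R).
  - apply/seteqP; split => // x _; exists (Num.truncn `|x|).+1 => //=.
    rewrite in_itv/= andbT ltrNl; apply: le_lt_trans (truncnS_gt _).
    by rewrite -normrN ler_norm.
  - move=> _ [a ->].
    transitivity (PY [set w | a < `|Y w 0| /\ B (spectral (Y w))]).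
      by congr (PY _); apply/seteqP; split => w /=; rewrite in_itv/= andbT.
    rewrite polar_ray// qE -(uniform_pareto_gt alpha_gt0) muleC.
    congr (_ * U _)%E; apply/seteqP; split => r /=; by rewrite in_itv/= andbT.
  - move=> n; apply: (@le_lt_trans _ _ (PY setT)); last by rewrite probability_setT ltry.
    by apply: le_measure; rewrite ?inE//; apply: measurableI => //; rewrite -[X in measurable X]setTI; exact: mY0.
pose G (z : R * Zdfield R d) := (g (fscale z.1 z.2))%:E.
have mG : measurable_fun setT G.
  apply/measurable_EFinP; apply: (measurableT_comp mg).
  exact: measurable_fscale measurable_fst measurable_snd.
have G0 z : (0 <= G z)%E by rewrite lee_fin.
transitivity (\int[J]_z G z)%E.
  rewrite integral_image//; apply: ae_eq_integral => //.
  - by apply/measurable_EFinP; exact: measurableT_comp mg mY.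
  - exact: measurableT_comp mG mJ.
  exists (~` [set w | 1 < `|Y w 0|]); split.
  - exact: measurableC.
  - have := probability_setC PY (mgt 1); rewrite Y0_gt1 subee//.
  move=> w /= h; apply: contra_not h => w1 _; rewrite /G/= fscale_spectral//.
  by rewrite -normr_gt0 (lt_trans _ w1).
rewrite (eq_measure_integral (m1 \x m2)%E); last first.
  by move=> A mA _; apply/esym; exact: product_measure_unique.
rewrite fubini_tonelli1// ge0_integral_distribution; last 2 first.
- exact: measurable_fun_fubini_tonelli_F.
- by move=> t; exact: integral_ge0.
rewrite integral_uniform01.
- apply: eq_integral => r _; rewrite /fubini_F /= ge0_integral_distribution//.
  exact: (measurableT_comp mG (pair1_measurable _)).
- apply: measurableT_comp => //; exact: measurable_fun_fubini_tonelli_F.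
- by move=> t; exact: integral_ge0.
Qed.

End Polar.

(** * Shift-invariant functionals of a clustered tail process *)

Section ClusterMean.
Context (R : realType) (d : nat).
Context (dO : measure_display) (O : measurableType dO) (P : probability O R).
Context (C : O -> Zdfield R d) (kappa : O -> R) (alpha c : R).
Hypothesis C_l0 : random_element_l0 C.
Hypothesis alpha_gt0 : 0 < alpha.
Hypothesis c_gt0 : 0 < c.
Hypothesis kappa_meas : measurable_fun setT kappa.
Hypothesis kappa_sign : forall w, kappa w = -1 \/ kappa w = 1.
Local Notation leb := (@lebesgue_measure R).
Local Notation V := (pareto alpha).

Lemma kappa_norm w : `|kappa w| = 1.
Proof. by have [->|->] := kappa_sign w; rewrite ?normrN normr1. Qed.

Let mnC : measurable_fun setT (fun w => fnorm (C w)).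
Proof. exact: measurable_fnorm C_l0.1 C_l0.2. Qed.

Lemma measurable_fnorm_powR : measurable_fun setT (fun w => fnorm (C w) `^ alpha).
Proof. exact: (measurableT_comp (measurable_powR alpha) mnC). Qed.

(** The event of the [k]th term of [ray_sum] is that [k] belongs to the
    exceedance set of the scaled cluster. *)
Lemma ray_sum_exceed (g : Zdfield R d -> R) w r : 0 < r ->
  let x := fscale (V r * kappa w) (C w) in
  ray_sum C kappa alpha g (w, r) =
  (\esum_(k in [set: Zd d]) (if 1 < `|x k| then g (fshift k x) else 0)%R%:E)%E.
Proof.
move=> r0 x; apply: eq_esum => k _; congr EFin; rewrite /ray_term/= r0/=.
rewrite -pareto_gt1// /x /fscale !normrM kappa_norm mulr1.
by rewrite gtr0_norm ?pareto_gt0.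
Qed.

Lemma fnorm_exceed w r : 0 < r ->
  (1 < fnorm (fscale (V r * kappa w) (C w))) = (r < fnorm (C w) `^ alpha).
Proof.
move=> r0; rewrite fnorm_fscale; last exact: C_l0.2.
rewrite normrM kappa_norm mulr1 gtr0_norm ?pareto_gt0// pareto_gt1//.
exact: fnorm_ge0 (C_l0.2 w).
Qed.

(** If the contributions of the exceedances of any field in [l0] add up to a
    scale-invariant quantity [psi], only the range of radii for which there
    is an exceedance matters; its length is the power [alpha] of the norm. *)
Lemma cluster_mean (g psi : Zdfield R d -> R) :
  measurable_fun setT g -> (forall x, 0 <= g x) ->
  (forall x, 0 <= psi x) ->
  (forall a x, 0 < a -> l0 x -> psi (fscale a x) = psi x) ->
  (forall x, l0 x ->
    \esum_(k in [set: Zd d]) (if 1 < `|x k| then g (fshift k x) else 0)%:E =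
    (if 1 < fnorm x then psi x else 0)%:E)%E ->
  (\int[P \x leb]_z ray_sum C kappa alpha g z =
   \int[P]_w (psi (fscale (kappa w) (C w)) * fnorm (C w) `^ alpha)%:E)%E.
Proof.
move=> mg g0 psi0 psi_scale gpsi.
have mr := @measurable_ray_sum _ _ _ _ _ _ alpha C_l0 kappa_meas g mg g0.
rewrite (@fubini_tonelli1 _ _ _ _ _ P leb _ mr (fun z => ray_sum_ge0 C kappa alpha z g0)).
apply: eq_integral => w _; rewrite /fubini_F.
have lC := C_l0.2 w; pose b := fnorm (C w) `^ alpha.
have b0 : 0 <= b by exact: powR_ge0.
pose q := psi (fscale (kappa w) (C w)).
transitivity (\int[leb]_r (q%:E * (\1_(`]0%R, b[%classic) r)%:E))%E.
  apply: eq_integral => r _; rewrite indicE mem_setE in_itv/=.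
  have [r0|r0] := ltP 0 r; last first.
    rewrite mule0 /ray_sum esum1// => k _; rewrite /ray_term/=.
    by rewrite ltNge r0.
  rewrite ray_sum_exceed// gpsi; last exact: l0_fscale.
  rewrite fnorm_exceed// -/b; case: ifP => _; last by rewrite mule0.
  by rewrite mule1 -fscaleA psi_scale ?pareto_gt0//; exact: l0_fscale.
rewrite ge0_integralZl_EFin//; last 2 first.
- by apply/measurable_EFinP; exact: measurable_indic.
- exact: psi0.
rewrite integral_indic// setIT.
rewrite -[LHS]/(q%:E * lebesgue_measure `]0%R, b[%classic)%E.
rewrite lebesgue_measure_itv/= lte_fin -EFinB subr0.
case: ifPn => [_|]; first by rewrite -EFinM.
rewrite -leNgt => b_le0; have bE : b = 0 by apply/eqP; rewrite eq_le b_le0.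
by rewrite -/b bE mulr0 mule0.
Qed.

Context (dY : measure_display) (OY : measurableType dY).
Context (dX : measure_display) (OX : measurableType dX).
Context (PX : probability OX R) (X : OX -> Zdfield R d).
Context (PY : probability OY R) (Y : OY -> Zdfield R d).
Hypothesis tailY : tail_process PX X PY Y.
Hypothesis Y_l0 : random_element_l0 Y.
Hypothesis tail_indexY : tail_index PY Y alpha.
Hypothesis mixY :
  mixture_representation P C kappa alpha c PY (@spectral R d \o Y).

Lemma tail_cluster_mean (g psi : Zdfield R d -> R) :
  measurable_fun setT g -> (forall x, 0 <= g x) ->
  (forall x, 0 <= psi x) ->
  (forall a x, 0 < a -> l0 x -> psi (fscale a x) = psi x) ->
  (forall x, l0 x ->
    \esum_(k in [set: Zd d]) (if 1 < `|x k| then g (fshift k x) else 0)%:E =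
    (if 1 < fnorm x then psi x else 0)%:E)%E ->
  (\int[PY]_w (g (Y w))%:E =
   (c^-1)%:E *
   \int[P]_w (psi (fscale (kappa w) (C w)) * fnorm (C w) `^ alpha)%:E)%E.
Proof.
move=> mg g0 psi0 psi_scale gpsi; rewrite -(cluster_mean mg)//.
rewrite (tail_process_polar tailY alpha_gt0 tail_indexY mg g0).
apply: (pareto_mixture C_l0 alpha_gt0 c_gt0 kappa_meas _ mixY) => //.
split; first exact: (measurableT_comp (@measurable_spectral R d) Y_l0.1).
by move=> w; apply: l0_fscale; exact: Y_l0.2.
Qed.

End ClusterMean.

Section ExceedanceCount.
Context (R : realType) (d : nat).
Implicit Types x : Zdfield R d.

Definition exceed_count x : \bar R :=
  (\esum_(k in [set: Zd d]) (\1_(exceed x) k)%:E)%E.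

Lemma exceed_countE x : finite_set (exceed x) ->
  exceed_count x = (#|` fset_set (exceed x)|%fset%:R)%:E.
Proof.
move=> fx; transitivity (\esum_(k in exceed x) (1%E : \bar R))%E.
  rewrite esum_mkcond; apply: eq_esum => k _; rewrite indicE.
  by case: ifP.
rewrite esum_fset// fsbig_finite//= sumEFin; congr EFin.
by rewrite big_const_seq count_predT iter_addr addr0.
Qed.

Lemma exceed_count_fshift k x : exceed_count (fshift k x) = exceed_count x.
Proof.
rewrite /exceed_count [RHS](@reindex_esum _ _ _ setT setT (fun j => j + k))//.
split => //; first by move=> i j _ _; exact: addIr.
by move=> j _; exists (j - k) => //; rewrite subrK.
Qed.

Definition inv_exceed_count x : R := (fine (exceed_count x))^-1.

Lemma measurable_inv_exceed_count : measurable_fun setT inv_exceed_count.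
Proof.
apply: measurable_funV_ge0; last first.
  by move=> x; rewrite fine_ge0// esum_ge0// => k _; rewrite lee_fin.
apply: (measurableT_comp (fine_measurable _)) => //.
apply: measurable_esum => [k|k x]; last by rewrite lee_fin.
apply/measurable_EFinP; rewrite (_ : (fun x => _) = \1_[set x : Zdfield R d | 1 < `|x k|]).
  by apply: measurable_indic; exact: measurable_coord_gt.
by apply/funext => x; rewrite !indicE; congr (nat_of_bool _)%:R; apply/idP/idP; rewrite !inE.
Qed.

(** Every exceedance contributes the inverse of their number. *)
Lemma esum_inv_exceed_count x : l0 x ->
  (\esum_(k in [set: Zd d])
     (if (1 < `|x k|)%R then inv_exceed_count (fshift k x) else 0%R)%:E =
   (if (1 < fnorm x)%R then 1%R else 0%R)%:E)%E.
Proof.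
move=> lx; have fx : finite_set (exceed x) := l0_finite_gt ltr01 lx.
have cx : exceed_count x = (fine (exceed_count x))%:E by rewrite exceed_countE.
transitivity ((inv_exceed_count x)%:E * exceed_count x)%E.
  rewrite /exceed_count -esumZl//; last first.
    by rewrite invr_ge0 fine_ge0// esum_ge0// => k _; rewrite lee_fin.
  apply: eq_esum => k _; rewrite /inv_exceed_count exceed_count_fshift indicE.
  case: ifPn => xk; first by rewrite mem_set// mule1.
  by rewrite memNset ?mule0//; exact/negP.
rewrite cx -EFinM; congr EFin; case: ifPn => [|x1].
  move=> /(fnorm_gtP _ lx)[i xi]; rewrite mulVf// exceed_countE//= pnatr_eq0.
  rewrite cardfs_eq0; apply/eqP => x0.
  have : i \in fset_set (exceed x) by rewrite in_fset_set// inE.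
  by rewrite x0 inE.
have -> : exceed_count x = 0%E; last by rewrite mulr0.
rewrite /exceed_count esum1// => k _; rewrite indicE memNset// => xk.
by move: x1; rewrite (lt_le_trans xk)// le_fnorm.
Qed.

End ExceedanceCount.

Section Anchoring.
Context (R : realType) (d : nat).
Implicit Types (x : Zdfield R d) (A : Zdfield R d -> Zd d).

(** Shift equivariance singles out one exceedance: seen from any exceedance [k],
    the anchor is the same site of the original field. *)
Lemma anchoring_unique A x : anchoring A -> l0 x -> 1 < fnorm x ->
  exists2 a, exceed x a &
    forall k, exceed x k -> (A (fshift k x) = 0 <-> k = a).
Proof.
move=> [_ Ae As] lx /(fnorm_gtP _ lx)[i xi].
have E0s k : exceed x k -> E0 (fshift k x).
  move=> xk; split; first by rewrite /fshift add0r.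
  exact: l0_finite_gt ltr01 (l0_fshift k lx).
have AE k : exceed x k -> A (fshift k x) + k = A (fshift i x) + i.
  move=> xk; have := As _ (E0s i xi) (k - i); rewrite fshiftD subrK => <-.
    by rewrite -addrA subrK.
  by rewrite /exceed /fshift/= subrK.
exists (A (fshift i x) + i).
  exact: Ae (E0s i xi).
move=> k xk; rewrite -(AE k xk); split => [->|/esym/eqP]; first by rewrite add0r.
by rewrite -subr_eq0 addrK => /eqP.
Qed.

Lemma measurable_anchored_at0 A : anchoring A -> measurable (anchored_at0 A).
Proof. by move=> [mA _ _]; exact: (mA [set 0]). Qed.

Lemma esum_anchored A (S : set (Zdfield R d)) x : anchoring A ->
  (forall y k, l0 y -> S (fshift k y) <-> S y) -> l0 x ->
  (\esum_(k in [set: Zd d])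
     (if (1 < `|x k|)%R then \1_(anchored_at0 A `&` S) (fshift k x) else 0%R)%:E =
   (if (1 < fnorm x)%R then \1_S x else 0%R)%:E :> \bar R)%E.
Proof.
move=> ancA Sshift lx; case: ifPn => x1; last first.
  rewrite esum1// => k _; case: ifPn => // xk.
  by move: x1; rewrite (lt_le_trans xk)// le_fnorm.
have [a xa ak] := anchoring_unique ancA lx x1.
have xE k : exceed x k ->
    \1_(anchored_at0 A `&` S) (fshift k x) = \1_[set a] k * \1_S x :> R.
  move=> xk; have Ek : E0 (fshift k x).
    split; first by rewrite /fshift add0r.
    exact: l0_finite_gt ltr01 (l0_fshift k lx).
  rewrite !indicE -natrM mulnb; congr (nat_of_bool _)%:R; apply/idP/idP.
    rewrite inE => -[[_ A0] Sx]; apply/andP; split; rewrite mem_set//.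
      exact: (ak k xk).1 A0.
    exact: (Sshift x k lx).1 Sx.
  move=> /andP[]; rewrite !inE/= => ka Sx; split; last exact/Sshift.
  by split => //; apply/ak.
rewrite (esum_eq1 (k := a)).
- by rewrite xa xE// indicE mem_set// mul1r.
- by rewrite xa lee_fin.
move=> j ja; case: ifPn => // xj; rewrite xE// indicE memNset ?mul0r//.
exact/eqP.
Qed.

End Anchoring.

Section Normalize.
Context (R : realType) (d : nat).
Implicit Types x : Zdfield R d.

(** Measurable retraction onto [l0]; the norm and the functionals of interest
    are measurable on [l0] only. *)
Definition retract_l0 x : Zdfield R d := if `[< l0 x >] then x else (fun=> 0).

Lemma retract_l0_id x : l0 x -> retract_l0 x = x.
Proof. by move=> lx; rewrite /retract_l0; case: asboolP. Qed.

Lemma l0_retract x : l0 (retract_l0 x).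
Proof.
rewrite /retract_l0; case: asboolP => // _ e e0; exists 0%N => i _.
by rewrite normr0.
Qed.

Lemma measurable_retract_l0 : measurable_fun setT retract_l0.
Proof.
apply: measurable_fun_if0; last exact: measurable_id.
rewrite (_ : mkset _ = @l0 R d); first exact: measurable_l0.
by apply/seteqP; split => x /= /asboolP.
Qed.

Definition normalized x : Zdfield R d :=
  fscale (fnorm (retract_l0 x))^-1 (retract_l0 x).

Lemma measurable_normalized : measurable_fun setT normalized.
Proof.
apply: measurable_fscale; last exact: measurable_retract_l0.
apply: measurable_funV_ge0; last by move=> x; exact: fnorm_ge0 (l0_retract x).
exact: measurable_fnorm measurable_retract_l0 l0_retract.
Qed.

Lemma l0_normalized x : l0 (normalized x).
Proof. exact: l0_fscale (l0_retract x). Qed.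

Lemma normalizedE x : l0 x -> normalized x = fscale (fnorm x)^-1 x.
Proof. by move=> lx; rewrite /normalized retract_l0_id. Qed.

Lemma normalized_fshift k x : l0 x -> normalized (fshift k x) = fshift k (normalized x).
Proof.
by move=> lx; rewrite !normalizedE// ?fnorm_fshift//; exact: l0_fshift.
Qed.

Lemma normalized_fscale a x : 0 < a -> l0 x -> normalized (fscale a x) = normalized x.
Proof.
move=> a0 lx; rewrite !normalizedE//; last exact: l0_fscale.
rewrite fnorm_fscale// gtr0_norm// fscaleA; congr fscale.
by rewrite invfM mulrAC mulVf ?lt0r_neq0// mul1r.
Qed.

Lemma measurable_l0_test (h : Zdfield R d -> R) : l0_test h ->
  measurable_fun setT (h \o retract_l0).
Proof.
move=> [mh _]; apply: (measurable_comp (F := @l0 R d)) => //.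
- exact: measurable_l0.
- by move=> _ [x _ <-]; exact: l0_retract.
- exact: measurable_retract_l0.
Qed.

End Normalize.

Section AnchoredSpectral.
Context (R : realType) (d : nat).
Context (dO : measure_display) (O : measurableType dO) (P : probability O R).
Context (C : O -> Zdfield R d) (kappa : O -> R) (alpha c : R).
Hypothesis C_l0 : random_element_l0 C.
Hypothesis alpha_gt0 : 0 < alpha.
Hypothesis c_gt0 : 0 < c.
Hypothesis kappa_meas : measurable_fun setT kappa.
Hypothesis kappa_sign : forall w, kappa w = -1 \/ kappa w = 1.
Context (dX dY : measure_display) (OX : measurableType dX) (OY : measurableType dY).
Context (PX : probability OX R) (X : OX -> Zdfield R d).
Context (PY : probability OY R) (Y : OY -> Zdfield R d).
Hypothesis tailY : tail_process PX X PY Y.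
Hypothesis Y_l0 : random_element_l0 Y.
Hypothesis tail_indexY : tail_index PY Y alpha.
Hypothesis mixY :
  mixture_representation P C kappa alpha c PY (@spectral R d \o Y).

(** Exactly one exceedance site of a field is its anchor, so the terms of the
    cluster sum add up to the indicator of [S]. *)
Lemma anchored_prob A (S : set (Zdfield R d)) : anchoring A -> measurable S ->
  (forall y k, l0 y -> S (fshift k y) <-> S y) ->
  (forall a y, 0 < a -> l0 y -> S (fscale a y) <-> S y) ->
  (PY (Y @^-1` (anchored_at0 A `&` S)) =
   (c^-1)%:E *
   \int[P]_w (\1_S (fscale (kappa w) (C w)) * fnorm (C w) `^ alpha)%:E)%E.
Proof.
move=> ancA mS Sshift Sscale.
have mAS : measurable (anchored_at0 A `&` S).
  by apply: measurableI => //; exact: measurable_anchored_at0.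
have mYAS : measurable (Y @^-1` (anchored_at0 A `&` S)).
  by rewrite -[X in measurable X]setTI; exact: Y_l0.1.
rewrite -(tail_cluster_mean C_l0 alpha_gt0 c_gt0 kappa_meas kappa_sign tailY
  Y_l0 tail_indexY mixY (g := \1_(anchored_at0 A `&` S)) (psi := \1_S)) //.
- by rewrite -[in LHS](setIT (Y @^-1` _)) -integral_indic.
- move=> a x a0 lx; rewrite !indicE; congr (nat_of_bool _)%:R.
  by apply/idP/idP; rewrite !inE => /Sscale; exact.
- by move=> x lx; exact: esum_anchored.
Qed.

Let mnC : measurable_fun setT (fun w => fnorm (C w) `^ alpha).
Proof. exact: measurable_fnorm_powR C_l0. Qed.

Let meanC : \bar R := (\int[P]_w (fnorm (C w) `^ alpha)%:E)%E.

Lemma extremal_indexE : extremal_index PY Y = ((c^-1)%:E * meanC)%E.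
Proof.
rewrite /extremal_index unlock.
transitivity (\int[PY]_w (inv_exceed_count (Y w))%:E)%E.
  apply: eq_integral => w _; congr EFin; rewrite /inv_exceed_count exceed_countE//.
  exact: l0_finite_gt ltr01 (Y_l0.2 w).
rewrite (tail_cluster_mean C_l0 alpha_gt0 c_gt0 kappa_meas kappa_sign tailY
  Y_l0 tail_indexY mixY (psi := cst 1)) //.
- by apply: (congr1 (mule _)); apply: eq_integral => w _; rewrite mul1r.
- exact: measurable_inv_exceed_count.
- by move=> x; rewrite invr_ge0 fine_ge0// esum_ge0// => k _; rewrite lee_fin.
- exact: esum_inv_exceed_count.
Qed.

Hypothesis cE :
  c%:E = (\esum_(k in [set: Zd d]) 'E_P[(fun w => `|C w k| `^ alpha)%R])%E.

(** Since [|C_k|] is at most the norm of [C], all summands of [c] would vanish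
    with this mean. *)
Lemma meanC_gt0 : (0 < meanC)%E.
Proof.
rewrite lt_neqAle integral_ge0 ?andbT//; last by move=> w _; rewrite lee_fin powR_ge0.
apply/eqP => /esym m0; move: c_gt0; rewrite -lte_fin cE esum1 ?ltxx// => k _.
rewrite unlock; apply/eqP; rewrite eq_le; apply/andP; split; last first.
  by apply: integral_ge0 => w _; rewrite lee_fin powR_ge0.
rewrite -m0; apply: ge0_le_integral => //.
- by apply/measurable_EFinP; exact: measurable_absC_powR C_l0 _.
- exact/measurable_EFinP.
move=> w _; rewrite lee_fin ge0_ler_powR ?nnegrE ?(ltW alpha_gt0)//.
  exact: fnorm_ge0 (C_l0.2 w).
exact: le_fnorm (C_l0.2 w).
Qed.

Lemma anchored_at0_prob A : anchoring A ->
  PY (Y @^-1` anchored_at0 A) = ((c^-1)%:E * meanC)%E.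
Proof.
move=> ancA; rewrite -[X in Y @^-1` X]setIT anchored_prob//.
by apply: (congr1 (mule _)); apply: eq_integral => w _; rewrite indicT mul1r.
Qed.

(** The laws of [h(Q)] and [h(Q^A)] on the line are compared, since shift
    invariance of [h] is inherited by the events [h^-1(D)]. *)
Lemma anchored_spectralE (dQ : measure_display) (OQ : measurableType dQ)
    (PQ : probability OQ R) (Q : OQ -> Zdfield R d) A h :
  random_element_l0 Q -> tilted_law P C kappa alpha PQ Q -> anchoring A ->
  l0_test h -> shift_invariant h ->
  ('E_PQ[h \o Q] =
   \int[anchored_law PY Y A]_(x in @l0 R d `&` @E0 R d)
     (h (fscale (fnorm x)^-1 x))%:E)%E.
Proof.
move=> Q_l0 tiltQ ancA ht hshift.
have mA := measurable_anchored_at0 ancA.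
pose H := h \o @retract_l0 R d; have mH : measurable_fun setT H := measurable_l0_test ht.
have H0 x : 0 <= H x by exact: ht.2 _ (l0_retract x).
have hH x : l0 x -> h x = H x by move=> lx; rewrite /H/= retract_l0_id.
have PA := anchored_at0_prob ancA.
have PAfin : PY (Y @^-1` anchored_at0 A) \is a fin_num.
  rewrite fin_num_measure// -[X in measurable X]setTI; exact: Y_l0.1.
pose q : R := fine (PY (Y @^-1` anchored_at0 A)).
have qE : PY (Y @^-1` anchored_at0 A) = q%:E by rewrite fineK.
have q0 : 0 < q.
  rewrite -lte_fin -qE PA; apply: mule_gt0; last exact: meanC_gt0.
  by rewrite lte_fin invr_gt0.
have meanE : meanC = (c * q)%:E.
  rewrite EFinM -qE PA muleA -EFinM mulfV ?mul1e//; exact: lt0r_neq0.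
have qV0 : 0 <= q^-1 by rewrite invr_ge0 ltW.
pose m := mscale (NngNum qV0) (mrestr (image_measure PY Y_l0.1) mA).
have -> : anchored_law PY Y A = m.
  apply/funext => B; rewrite /anchored_law qE inver gt_eqF//= muleC.
  by [].
have mlE : measurable (@l0 R d `&` @E0 R d).
  by apply: measurableI; [exact: measurable_l0|exact: measurable_E0].
have mN : measurable_fun setT (fun x => H (normalized x)).
  exact: measurableT_comp mH (@measurable_normalized R d).
transitivity (\int[m]_x (H (normalized x))%:E)%E; last first.
  rewrite (ge0_negligible_integral (N := ~` (@l0 R d `&` @E0 R d)))//.
  - rewrite setTD setCK; apply: eq_integral => x; rewrite inE => -[lx _].
    by rewrite normalizedE// hH//; exact: l0_fscale.
  - exact: measurableC.
  - exact/measurable_EFinP.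
  - by move=> x _; rewrite lee_fin.
  rewrite -[LHS]/(_ * PY _)%E (_ : Y @^-1` _ = set0) ?measure0 ?mule0//.
  apply/seteqP; split => // w [nlE [e0 _]]; apply: nlE; split => //.
  exact: Y_l0.2.
have mHQ : measurable_fun setT (fun w => H (Q w)) by exact: measurableT_comp mH Q_l0.1.
transitivity (\int[image_measure PQ mHQ]_y (`|y|)%:E)%E.
  rewrite unlock integral_image//.
    by apply: eq_integral => w _ /=; rewrite ger0_norm// hH//; exact: Q_l0.2.
  by apply/measurable_EFinP; exact: normr_measurable.
transitivity (\int[image_measure m mN]_y (`|y|)%:E)%E; last first.
  rewrite integral_image//.
    by apply: eq_integral => w _ /=; rewrite ger0_norm.
  by apply/measurable_EFinP; exact: normr_measurable.
apply: eq_measure_integral => D mD _.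
pose S := [set x | D (H (normalized x))].
have mS : measurable S by have := mN measurableT D mD; rewrite setTI.
transitivity ((q^-1)%:E * PY (Y @^-1` (anchored_at0 A `&` S)))%E; last first.
  by rewrite setIC.
have Sshift y k : l0 y -> S (fshift k y) <-> S y.
  move=> ly; rewrite /S/= normalized_fshift//.
  rewrite -!hH ?hshift//; [exact: l0_normalized|exact: l0_normalized|].
  exact: l0_fshift (l0_normalized y).
have Sscale a y : 0 < a -> l0 y -> S (fscale a y) <-> S y.
  by move=> a0 ly; rewrite /S/= normalized_fscale.
rewrite anchored_prob//.
have mHD : measurable (H @^-1` D) by have := mH measurableT D mD; rewrite setTI.
rewrite -[LHS]/(PQ (Q @^-1` (H @^-1` D))) tiltQ//.
have -> : ('E_P[(fun w => fnorm (C w) `^ alpha)%R] = meanC)%E by rewrite unlock.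
rewrite meanE inver mulf_eq0 !gt_eqF//= muleC muleA -EFinM -invfM [(q * c)%R]mulrC.
apply: (congr1 (mule _)); apply: eq_integral => w _; congr EFin.
have lC := C_l0.2 w; case: eqP => [->|/eqP C0].
  by rewrite powR0 ?mulr0// lt0r_neq0.
congr (_ * _); rewrite !indicE; congr (nat_of_bool _)%:R.
have -> : fscale (kappa w / fnorm (C w)) (C w) =
    normalized (fscale (kappa w) (C w)).
  rewrite normalizedE; last exact: l0_fscale.
  by rewrite fnorm_fscale// (kappa_norm kappa_sign) mul1r fscaleA mulrC.
by apply/idP/idP; rewrite !inE.
Qed.

End AnchoredSpectral.

(** * Existence of an anchoring function *)

Section Lexicographic.
Variable d : nat.
Implicit Types i j k : Zd d.

Definition lexlt i j := exists n : 'I_d,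
  (forall m : 'I_d, (m < n)%N -> i ord0 m = j ord0 m) /\ (i ord0 n < j ord0 n)%R.

Lemma lexlt_irr i : ~ lexlt i i.
Proof. by move=> [n [_]]; rewrite ltxx. Qed.

Lemma lexlt_trans j i k : lexlt i j -> lexlt j k -> lexlt i k.
Proof.
move=> [n [ijE ij]] [m [jkE jk]].
have [nm|mn|/val_inj nm] := ltngtP n m.
- exists n; split=> [l ln|]; first by rewrite ijE// jkE// (ltn_trans ln).
  by rewrite -jkE.
- exists m; split=> [l lm|]; first by rewrite ijE ?jkE// (ltn_trans lm).
  by rewrite ijE.
- move: jkE jk; rewrite -nm => jkE jk.
  exists n; split=> [l ln|]; [by rewrite ijE ?jkE|exact: lt_trans jk].
Qed.

Lemma lexlt_total i j : i != j -> lexlt i j \/ lexlt j i.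
Proof.
move=> ij; have [n nij] : exists n, i ord0 n != j ord0 n.
  apply/existsP; rewrite -negb_forall; apply: contra ij => /forallP h.
  by apply/eqP/rowP => n; apply/eqP.
case: (@arg_minnP _ n (fun n => i ord0 n != j ord0 n) val nij) => m mij mmin.
have E (l : 'I_d) : (l < m)%N -> i ord0 l = j ord0 l.
  by move=> lm; apply/eqP; apply: contraTT lm => /mmin; rewrite -leqNgt.
have /orP[lt|lt] := lt_total mij; [left|right]; exists m; split => // l lm.
by rewrite E.
Qed.

Lemma lexlt_addr k i j : lexlt (i + k) (j + k) <-> lexlt i j.
Proof.
split=> -[n [E ij]]; exists n; split.
- by move=> m /E; rewrite !mxE => /addIr.
- by move: ij; rewrite !mxE ltrD2r.
- by move=> m /E; rewrite !mxE => ->.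
- by rewrite !mxE ltrD2r.
Qed.

Definition lexmin (S : set (Zd d)) i :=
  S i /\ forall j, S j -> j != i -> lexlt i j.

Lemma lexmin_unique S i j : lexmin S i -> lexmin S j -> i = j.
Proof.
move=> [Si mi] [Sj mj]; apply/eqP/negPn/negP => ij.
apply: (@lexlt_irr i); apply: lexlt_trans (mj _ Si ij).
by apply: mi; rewrite // eq_sym.
Qed.

Lemma lexmin_exists S : finite_set S -> S !=set0 -> exists i, lexmin S i.
Proof.
move=> fS [x Sx].
have memS j : (j \in (fset_set S : seq _)) = (j \in S).
  by rewrite -(in_fset_set fS).
suff [i [iS mi]] : exists i, i \in (fset_set S : seq _) /\
    forall j, j \in (fset_set S : seq _) -> j != i -> lexlt i j.
  exists i; split=> [|j Sj]; first by move: iS; rewrite memS inE.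
  by apply: mi; rewrite memS inE.
have : x \in (fset_set S : seq _) by rewrite memS inE.
move: (fset_set S : seq _) => s; elim: s x {Sx} => // y s IH x _.
case: s IH => [_|z s IH].
  by exists y; split=> [|j]; rewrite inE// => /eqP ->; rewrite eqxx.
have [i [si mi]] := IH z (mem_head z s).
have [yi|yi] := eqVneq y i.
  exists i; split=> [|j]; first by rewrite inE si orbT.
  by rewrite inE => /predU1P[->|]; [rewrite yi eqxx|exact: mi].
have [lt|lt] := lexlt_total yi.
  exists y; split=> [|j]; first exact: mem_head.
  rewrite inE => /predU1P[->|js _]; first by rewrite eqxx.
  have [->//|ji] := eqVneq j i; exact: lexlt_trans (mi _ js ji).
exists i; split=> [|j]; first by rewrite inE si orbT.
by rewrite inE => /predU1P[->|]; [|exact: mi].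
Qed.

End Lexicographic.

(** The lexicographic order is invariant under translations, so the first
    exceedance is an equivariant choice. *)
Lemma anchoring_exists (R : realType) (d : nat) :
  exists A : Zdfield R d -> Zd d, anchoring A.
Proof.
pose A (x : Zdfield R d) : Zd d := xget 0 (lexmin (exceed x)).
have AP x : E0 x -> lexmin (exceed x) (A x).
  move=> [x0 fx]; have [i xi] := lexmin_exists fx (ex_intro _ 0 x0).
  exact: (xgetPex 0 (ex_intro _ i xi)).
exists A; split.
- move=> B.
  rewrite (_ : _ `&` _ = @E0 R d `&`
      \bigcup_k [set x | B k /\ lexmin (exceed x) k]); last first.
    apply/seteqP; split => x [Ex].
      by move=> Bx; split => //; exists (A x) => //; split => //; exact: AP.
    move=> [k _ [Bk kx]]; split => //=.
    by rewrite (lexmin_unique (AP x Ex) kx).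
  apply: measurableI; first exact: measurable_E0.
  apply: measurable_bigcup_countable => k.
  have [Bk|Bk] := pselect (B k); last first.
    by rewrite (_ : [set _ | _] = set0)//; apply/seteqP; split => x //= [].
  rewrite (_ : [set _ | _] = [set x : Zdfield R d | 1 < `|x k|] `&`
      \bigcap_j [set x | exceed x j -> j != k -> lexlt k j]); last first.
    apply/seteqP; split => x /=.
      by move=> [_ [xk kmin]]; split => // j _; exact: kmin.
    by move=> [xk kmin]; split => //; split => // j; exact: kmin.
  apply: measurableI; first exact: measurable_coord_gt.
  apply: measurable_bigcap_countable => j.
  have [kj|kj] := pselect (j != k -> lexlt k j).
    by rewrite (_ : [set _ | _] = setT)//; apply/seteqP; split => x //= _ _.
  rewrite (_ : [set _ | _] = ~` [set x : Zdfield R d | 1 < `|x j|]).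
    by apply: measurableC; exact: measurable_coord_gt.
  by apply/seteqP; split => x /= h xj; [apply: kj; exact: h|].
- by move=> x /AP[].
move=> x Ex k xk.
have Exk : E0 (fshift k x).
  case: Ex => _ /finite_Zd_bounded[m xm]; split; first by rewrite /fshift add0r.
  apply/finite_Zd_bounded; exists (m + absZ k)%N => i /xm h.
  have := absZD (i + k) (- k); rewrite addrK absZN => /leq_trans; apply.
  by rewrite leq_add2r.
apply: (lexmin_unique _ (AP x Ex)).
have [Ak Amin] := AP _ Exk; split; first exact: Ak.
move=> j xj jA; rewrite -(subrK k j); apply/lexlt_addr; apply: Amin.
  by rewrite /exceed /fshift/= subrK.
by apply: contra jA => /eqP <-; rewrite subrK.
Qed.

(** * Observables of a box are measurable *)

Section BoxMeasurable.
Context (R : realType) (d m : nat).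

Let rounded (n : nat) (x : Zdfield R d) : {ffun torus d m -> int} :=
  [ffun a => Num.floor (n.+1%:R * x (unwrap a))].

Let unrounded (n : nat) (v : {ffun torus d m -> int}) : Zdfield R d :=
  fun i => (v (wrap m i))%:~R / n.+1%:R.

Let measurable_rounded n v : measurable [set x | rounded n x = v].
Proof.
rewrite (_ : [set _ | _] = \bigcap_a
    [set x | (v a)%:~R <= n.+1%:R * x (unwrap a) < (v a + 1)%:~R]); last first.
  apply/seteqP; split => x /=.
    by move=> <- a _ /=; rewrite ffunE floor_itv.
  by move=> xv; apply/ffunP => a; rewrite ffunE; apply: floor_def; exact: xv a I.
apply: measurable_bigcap_countable => a.
have mx : measurable_fun setT (fun x : Zdfield R d => n.+1%:R * x (unwrap a)).
  by apply: measurable_funM => //; exact: measurable_coord.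
rewrite (_ : [set _ | _] = (~` [set x : Zdfield R d | n.+1%:R * x (unwrap a) < (v a)%:~R]) `&`
    [set x | n.+1%:R * x (unwrap a) < (v a + 1)%:~R]).
  by apply: measurableI; [apply: measurableC|]; exact: measurable_ltr.
apply/seteqP; split => x /=.
  by move=> /andP[h ->]; split => //; apply/negP; rewrite -leNgt.
by move=> [/negP]; rewrite -leNgt => -> ->.
Qed.

Let rounded_near (x : Zdfield R d) i : (absZ i <= m)%N ->
  unrounded n (rounded n x) i @[n --> \oo] --> x i.
Proof.
move=> im; rewrite /unrounded /rounded; under eq_fun do rewrite ffunE wrapK//.
apply/cvgrPdist_le => e e0; near=> n.
have n0 : 0 < n.+1%:R :> R by [].
have := floor_itv (n.+1%:R * x i) => /andP[f1 f2].
have h1 : (Num.floor (n.+1%:R * x i))%:~R / n.+1%:R <= x i.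
  by rewrite ler_pdivrMr// [x i * _]mulrC.
rewrite ger0_norm ?subr_ge0// lerBlDr.
have h2 : x i <= ((Num.floor (n.+1%:R * x i))%:~R + 1) / n.+1%:R.
  by rewrite ler_pdivlMr// [x i * _]mulrC ltW// -[1]/(1%:~R) -intrD.
apply: (le_trans h2); rewrite mulrDl mul1r addrC lerD2r.
by apply: ltW; near: n; exact: near_infty_natSinv_lt (PosNum e0).
Unshelve. all: by end_near. Qed.

(** A continuous function of finitely many coordinates is the limit of its values
    at the roundings of the coordinates, and the rounded points are countable in
    number. *)
Lemma measurable_box_observable (f : {ptws box d m -> R} -> R) : continuous f ->
  measurable_fun setT (fun x : Zdfield R d => f (box_restr x)).
Proof.
move=> cf; apply: (measurable_fun_cvg
  (h := fun n x => f (box_restr (unrounded n (rounded n x))))) => //.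
  move=> n; apply: (measurable_fun_diag
    (F := fun v _ => f (box_restr (unrounded n v))) (N := rounded n)) => v.
    exact: measurable_rounded.
  exact: measurable_cst.
move=> x _.
have h : (box_restr (unrounded n (rounded n x)) : {ptws box d m -> R}) @[n --> \oo] -->
    (box_restr x : {ptws box d m -> R}).
  apply/cvg_sup => i U [V] [[W] oW <-] WfN WU.
  apply: (filterS WU); rewrite nbhs_simpl /=.
  have hi := @rounded_near x (val i) (valP i).
  apply: hi.
  exact: open_nbhs_nbhs.
by apply: (cvg_comp _ _ h); exact: cf.
Qed.

End BoxMeasurable.

(** * A stationary field of periodised clusters *)

Section PeriodLevel.
Context (R : realType) (d : nat).

Definition period_size (m : nat) : R := #|{: torus d m}|%:R.

Lemma period_sizeE m : period_size m = ((m.*2.+1) ^ d)%:R.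
Proof. by rewrite /period_size /torus card_mx card_ord mul1n. Qed.

Lemma period_size_gt0 m : 0 < period_size m.
Proof. by rewrite period_sizeE ltr0n expn_gt0. Qed.

(** Below height [period_threshold m] the period is at least [2 m + 1]. The
    thresholds decay so fast that the expected number of sites in a period is
    finite. *)
Definition period_threshold (m : nat) : R := (2 ^+ m * period_size m)^-1.

Lemma period_threshold_gt0 m : 0 < period_threshold m.
Proof. by rewrite invr_gt0 mulr_gt0 ?exprn_gt0 ?period_size_gt0. Qed.

Lemma period_threshold0 : period_threshold 0 = 1.
Proof. by rewrite /period_threshold period_sizeE expr0 mul1r exp1n invr1. Qed.

Lemma period_threshold_le m n : (m <= n)%N -> period_threshold n <= period_threshold m.
Proof.
move=> mn; rewrite lef_pV2 ?posrE ?mulr_gt0 ?exprn_gt0 ?period_size_gt0//.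
apply: ler_pM; rewrite ?exprn_ge0 ?(ltW (period_size_gt0 _))//.
  by rewrite ler_weXn2l ?ler1n.
rewrite !period_sizeE ler_nat; have [->|d0] := posnP d; first by rewrite !expn0.
by rewrite leq_exp2r// ltnS leq_double.
Qed.

Lemma period_threshold_lt s : 0 < s -> exists n, period_threshold n.+1 < s.
Proof.
move=> s0; have [n ns] : exists n, n.+1%:R^-1 < s.
  have := near_infty_natSinv_lt (PosNum s0).
  by case => n _ /(_ n (leqnn _)) /=; exists n.
exists n; apply: le_lt_trans ns; rewrite lef_pV2 ?posrE ?mulr_gt0 ?exprn_gt0 ?period_size_gt0//.
rewrite -[leLHS]mulr1; apply: ler_pM => //.
  by rewrite -natrX ler_nat ltnW// ltn_expl.
by rewrite period_sizeE ler1n expn_gt0.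
Qed.

(** The radius of the period at height [s]; it tends to infinity as [s]
    decreases to 0. *)
Definition level (s : R) : nat :=
  if pselect (exists n, period_threshold n.+1 < s) is left h then ex_minn h else 0%N.

Lemma le_threshold_level s : 0 < s <= 1 -> s <= period_threshold (level s).
Proof.
move=> /andP[s0 s1]; rewrite /level; case: pselect => [h|]; last first.
  by move/(_ (period_threshold_lt s0)).
case: ex_minnP => -[|n] hn nmin; first by rewrite period_threshold0.
by rewrite leNgt; apply/negP => /nmin; rewrite ltnn.
Qed.

Lemma level_ge m s : 0 < s <= period_threshold m -> (m <= level s)%N.
Proof.
move=> /andP[s0 sm]; rewrite /level; case: pselect => [h|]; last first.
  by move/(_ (period_threshold_lt s0)).
case: ex_minnP => n hn _; rewrite leqNgt; apply/negP => nm.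
by move: hn; rewrite ltNge (le_trans sm)// period_threshold_le.
Qed.

Lemma measurable_level m : measurable (level @^-1` [set m]).
Proof.
have mge t : measurable [set s : R | t < s] by exact: measurable_ltr.
have mle t : measurable [set s : R | s <= t].
  rewrite (_ : [set s | s <= t] = ~` [set s | t < s]); first exact: measurableC.
  by apply/seteqP; split => s /=; rewrite leNgt => /negP.
rewrite (_ : _ @^-1` _ =
    ([set s | period_threshold m.+1 < s] `&`
     \bigcap_n [set s | (n < m)%N -> s <= period_threshold n.+1]) `|`
    (if m == 0%N then \bigcap_n [set s | s <= period_threshold n.+1] else set0)).
  apply: measurableU.
    apply: measurableI => //; apply: bigcapT_measurable => n.
    have [nm|nm] := ltnP n m.
      rewrite (_ : [set _ | _] = [set s | s <= period_threshold n.+1])//.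
      by apply/seteqP; split => s /= => [|? _]; [apply|].
    by rewrite (_ : [set _ | _] = setT)//; apply/seteqP; split => s.
  by case: ifP => // _; exact: bigcapT_measurable.
apply/seteqP; split => s /=; rewrite /level.
  case: pselect => [h <-|h <-].
    case: ex_minnP => n hn nmin; left; split => // k _ kn.
    by rewrite leNgt; apply/negP => /nmin; rewrite leqNgt kn.
  right; rewrite eqxx => n _ /=; rewrite leNgt; apply/negP => hn; apply: h.
  by exists n.
move=> [[hm hmin]|].
  case: pselect => [h|]; last by move/(_ (ex_intro _ m hm)).
  case: ex_minnP => n hn nmin; apply/eqP; rewrite eqn_leq nmin//= leqNgt.
  by apply/negP => /(hmin n I); rewrite leNgt hn.
case: eqP => // -> h; case: pselect => // -[n hn].
by have := h n I; rewrite /= leNgt hn.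
Qed.

End PeriodLevel.

Section Periodise.
Context (R : realType) (d : nat).
Local Open Scope ereal_scope.

(** The restriction of [x] to the box of radius [m], repeated periodically. *)
Definition periodised (m : nat) (x : Zdfield R d) : Zdfield R d :=
  fun i => x (unwrap (wrap m i)).

Lemma measurable_periodised m : measurable_fun setT (periodised m).
Proof. by apply: measurable_field => i; exact: measurable_coord. Qed.

Lemma esum_box_torus m (f : torus d m -> \bar R) :
  \esum_(j in [set: Zd d]) (if (absZ j <= m)%N then f (wrap m j) else 0) =
  \esum_(a in [set: torus d m]) f a.
Proof.
transitivity (\esum_(j in [set j : Zd d | (absZ j <= m)%N]) f (wrap m j)).
  rewrite [RHS]esum_mkcond; apply: eq_esum => j _.
  by case: ifPn => jm; [rewrite mem_set|rewrite memNset//; exact/negP].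
rewrite (@reindex_esum _ _ _ [set: torus d m] _ (@unwrap d m)).
  by apply: eq_esum => a _; rewrite unwrapK.
split; last by move=> j jm; exists (wrap m j) => //; rewrite wrapK.
  by move=> a _; exact: absZ_unwrap.
by move=> a b _ _; exact: unwrap_inj.
Qed.

(** Summing over a full period does not depend on where the period starts. *)
Lemma esum_periodised_shift m (g : Zdfield R d -> \bar R) (a : R) x k :
  \esum_(j in [set: Zd d])
    (if (absZ j <= m)%N
     then g (fshift k (fscale a (fshift j (periodised m x)))) else 0) =
  \esum_(j in [set: Zd d])
    (if (absZ j <= m)%N then g (fscale a (fshift j (periodised m x))) else 0).
Proof.
pose F (b : torus d m) := g (fun i => a * x (unwrap (wrap m i + b)%R))%R.
have E j : fscale a (fshift j (periodised m x)) =
    (fun i => a * x (unwrap (wrap m i + wrap m j)%R))%R.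
  by apply/funext => i; rewrite /fscale /fshift /periodised wrapD.
have E' j : fshift k (fscale a (fshift j (periodised m x))) =
    (fun i => a * x (unwrap (wrap m i + (wrap m k + wrap m j))%R))%R.
  by rewrite E; apply/funext => i; rewrite /fshift wrapD addrA.
under eq_esum do rewrite E'.
under [RHS]eq_esum do rewrite E.
rewrite (esum_box_torus (fun b => F (wrap m k + b)%R)) (esum_box_torus F).
rewrite [RHS](@reindex_esum _ _ _ setT setT (fun b => wrap m k + b)%R)//.
Qed.

Lemma esum_box_card m :
  \esum_(j in [set: Zd d]) (if (absZ j <= m)%N then 1 else 0) = (period_size R d m)%:E.
Proof.
rewrite (esum_box_torus (fun=> 1)) esum_fset//; last exact: finite_finset.
rewrite (@fsbigE _ _ _ _ _ (enum {: torus d m})) ?enum_uniq//; last first.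
  by move=> a _; rewrite mem_enum.
rewrite sumEFin; congr EFin; rewrite big_const_seq iter_addr addr0.
rewrite (eq_count (a2 := predT)) ?count_predT; last by move=> a; rewrite /= in_setT.
by rewrite /period_size cardE.
Qed.

End Periodise.

(** Tonelli's theorem for the product with the counting measure of the codes. *)
HB.instance Definition _ (R : realType) := @isSFinite.Build _ _ _ (@counting nat R)
  (sfinite_measure_sigma_finite (sigma_finite_counting R)).

Section MovingCluster.
Context (R : realType) (d : nat).
Context (dO : measure_display) (O : measurableType dO) (P : probability O R).
Context (C : O -> Zdfield R d) (kappa : O -> R) (alpha : R).
Hypothesis C_l0 : random_element_l0 C.
Hypothesis kappa_meas : measurable_fun setT kappa.
Local Notation U := (@uniform_prob R 0 1 ltr01).
Local Notation V := (pareto alpha).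

Definition radial_law : probability (O * measurableTypeR R)%type R := (P \x U)%E.
Local Notation Pr := radial_law.

Local Notation level := (@level R d).
Local Notation site n := (@pickle_inv (Zd d) n).

Definition placed_cluster (m : nat) (j : Zd d) (y : O * R) : Zdfield R d :=
  fscale (V y.2 * kappa y.1) (fshift j (periodised m (C y.1))).

(** The sample space carries the cluster, its radius and the code of a site of
    the period that the radius prescribes. *)
Definition moving_cluster (z : (O * R) * nat) : Zdfield R d :=
  placed_cluster (level z.1.2) (odflt 0 (site z.2)) z.1.

Definition moving_dom : set ((O * R) * nat) :=
  [set z | (0 < z.1.2 <= 1) &&
    oapp (fun j => absZ j <= level z.1.2)%N false (site z.2)].

Lemma measurable_placed_cluster m j : measurable_fun setT (placed_cluster m j).
Proof.
apply: measurable_fscale.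
  apply: measurable_funM; last exact: (measurableT_comp kappa_meas measurable_fst).
  exact: (measurableT_comp (measurable_pareto alpha) measurable_snd).
apply: (measurableT_comp (measurable_fshift j)).
apply: (measurableT_comp (@measurable_periodised R d m)).
exact: (measurableT_comp C_l0.1 measurable_fst).
Qed.

Let measurable_level2 m : measurable [set y : O * R | level y.2 = m].
Proof.
rewrite (_ : [set _ | _] = setT `&` snd @^-1` (level @^-1` [set m])).
  by apply: measurable_snd => //; exact: measurable_level.
by rewrite setTI.
Qed.

Lemma measurable_placed_cluster_level j :
  measurable_fun setT (fun y : O * R => placed_cluster (level y.2) j y).
Proof.
apply: (measurable_fun_diag (F := fun m y => placed_cluster m j y)
  (N := fun y : O * R => level y.2)) => // m.
exact: measurable_placed_cluster.
Qed.

Lemma measurable_moving_cluster : measurable_fun setT moving_cluster.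
Proof.
apply: (measurable_fun_diag (F := fun n z =>
    placed_cluster (level z.1.2) (odflt 0 (site n)) z.1)
  (N := fun z : (O * R) * nat => z.2)) => [n|n].
  by rewrite -[X in measurable X]setTI; exact: measurable_snd.
exact: (measurableT_comp (measurable_placed_cluster_level _) measurable_fst).
Qed.

Let measurable_radius : measurable [set y : O * R | 0 < y.2 <= 1].
Proof.
rewrite (_ : [set _ | _] = [set y : O * R | 0 < y.2] `&` ~` [set y | 1 < y.2]).
  by apply: measurableI; last apply: measurableC; exact: measurable_ltr.
apply/seteqP; split => y /=; first by move=> /andP[-> h]; split=> //; apply/negP; rewrite -leNgt.
by move=> [-> /negP]; rewrite leNgt.
Qed.

Lemma measurable_moving_dom : measurable moving_dom.
Proof.
rewrite (_ : moving_dom = (fst @^-1` [set y : O * R | 0 < y.2 <= 1]) `&`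
  \bigcup_m \bigcup_n [set z : (O * R) * nat |
    [/\ level z.1.2 = m, z.2 = n &
        oapp (fun j => absZ j <= m)%N false (site n)]]); last first.
  apply/seteqP; split => z.
    by move=> /andP[z1 z2]; split => //; exists (level z.1.2) => //; exists z.2.
  by move=> [z1 [m _ [n _ [/= <- <- h]]]]; apply/andP.
apply: measurableI; first by rewrite -[X in measurable X]setTI; exact: measurable_fst.
apply: bigcupT_measurable => m; apply: bigcupT_measurable => n.
case h : (oapp (fun j => absZ j <= m)%N false (site n)); last first.
  by rewrite (_ : [set _ | _] = set0)//; apply/seteqP; split => z //= [].
rewrite (_ : [set _ | _] = (fst @^-1` [set y : O * R | level y.2 = m]) `&` (snd @^-1` [set n])).
  apply: measurableI; rewrite -[X in measurable X]setTI.
    by apply: measurable_fst => //; exact: measurable_level2.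
  exact: measurable_snd.
by apply/seteqP; split => z /= [].
Qed.

Let measurable_moving_domT :
  measurable (moving_dom : set ((O * measurableTypeR R) * nat)).
Proof. exact: measurable_moving_dom. Qed.

Let base_measure : {measure set ((O * measurableTypeR R) * nat) -> \bar R} :=
  (Pr \x (@counting nat R))%E.

Definition moving_measure :
    {measure set ((O * measurableTypeR R) * nat) -> \bar R} :=
  mrestr base_measure measurable_moving_domT.

(** What remains of [g \o moving_cluster] once the code of the site is integrated
    out. *)
Definition site_sum (g : Zdfield R d -> \bar R) (y : O * R) : \bar R :=
  if 0 < y.2 <= 1 then
    (\esum_(j in [set: Zd d])
      (if (absZ j <= level y.2)%N then g (placed_cluster (level y.2) j y) else 0))%E
  else 0%E.

Let site_term (g : Zdfield R d -> \bar R) (j : Zd d) (y : O * R) : \bar R :=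
  if (0 < y.2 <= 1) && (absZ j <= level y.2)%N
  then g (placed_cluster (level y.2) j y) else 0%E.

Let site_sumE g y : site_sum g y = (\esum_(j in [set: Zd d]) site_term g j y)%E.
Proof.
rewrite /site_sum /site_term; case: ifP => // _.
by rewrite esum1.
Qed.

Let measurable_site_term g j : measurable_fun setT g ->
  measurable_fun setT (site_term g j).
Proof.
move=> mg; apply: measurable_fun_if0; last first.
  exact: (measurableT_comp mg (measurable_placed_cluster_level j)).
rewrite (_ : mkset _ = [set y : O * R | 0 < y.2 <= 1] `&`
   \bigcup_m [set y | level y.2 = m /\ (absZ j <= m)%N]).
  apply: measurableI => //; apply: bigcupT_measurable => m.
  have [jm|jm] := leqP (absZ j) m.
    rewrite (_ : [set _ | _] = [set y : O * R | level y.2 = m])//.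
    by apply/seteqP; split => y //= [].
  by rewrite (_ : [set _ | _] = set0)//; apply/seteqP; split => y //= [].
apply/seteqP; split => y /=.
  by move=> /andP[h1 h2]; split => //; exists (level y.2).
by move=> [-> [m _ [<- ->]]].
Qed.

Lemma measurable_site_sum g : measurable_fun setT g -> (forall x, 0 <= g x)%E ->
  measurable_fun setT (site_sum g).
Proof.
move=> mg g0; rewrite (_ : site_sum g = fun y => \esum_(j in [set: Zd d]) site_term g j y)%E;
  last by apply/funext => y; exact: site_sumE.
apply: measurable_esum => [j|j y]; first exact: measurable_site_term.
by rewrite /site_term; case: ifP.
Qed.

Lemma site_sum_ge0 g y : (forall x, 0 <= g x)%E -> (0 <= site_sum g y)%E.
Proof.
move=> g0; rewrite site_sumE; apply: esum_ge0 => j _.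
by rewrite /site_term; case: ifP.
Qed.

Lemma integral_moving_cluster (g : Zdfield R d -> \bar R) :
  measurable_fun setT g -> (forall x, 0 <= g x)%E ->
  (\int[moving_measure]_z g (moving_cluster z) =
   \int[Pr]_y site_sum g y)%E.
Proof.
move=> mg g0; have mD := measurable_moving_domT.
pose T := ((O * measurableTypeR R) * nat)%type.
have mgX : measurable_fun setT (g \o moving_cluster : T -> \bar R).
  exact: measurableT_comp mg measurable_moving_cluster.
rewrite (ge0_negligible_integral (N := ~` (moving_dom : set T)))//; last 2 first.
- exact: measurableC.
- by rewrite /moving_measure /= /mrestr setICl measure0.
rewrite setTD setCK.
rewrite (eq_measure_integral (Pr \x (@counting nat R))%E); last first.
  by move=> A mA AD; rewrite /moving_measure /= /mrestr setIidl.
rewrite integral_mkcond.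
have mG : measurable_fun setT ((g \o moving_cluster) \_ moving_dom).
  exact: (measurable_restrictT (g \o moving_cluster : T -> \bar R) mD).1 (measurable_funTS mgX).
have G0 z : (0 <= ((g \o moving_cluster) \_ moving_dom) z)%E.
  by rewrite patchE; case: ifP => // _; exact: g0.
rewrite (@fubini_tonelli1 _ _ _ _ _ Pr (@counting nat R) _ mG G0).
apply: eq_integral => y _; rewrite /fubini_F ge0_integral_count//.
rewrite site_sumE esum_nneseries; last by move=> j; rewrite /site_term; case: ifP.
apply: eq_eseriesr => n _; rewrite patchE /moving_cluster/=.
case: ifPn; rewrite ?inE ?notin_setE /moving_dom/=.
  by case: pickle_inv => [j|] /=; rewrite ?andbF// /site_term => ->.
by case: pickle_inv => [j|] //= /negP/negbTE; rewrite /site_term => ->.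
Qed.

End MovingCluster.

Section MovingField.
Context (R : realType) (d : nat).
Context (dO : measure_display) (O : measurableType dO) (P : probability O R).
Context (C : O -> Zdfield R d) (kappa : O -> R) (alpha : R).
Hypothesis C_l0 : random_element_l0 C.
Hypothesis kappa_meas : measurable_fun setT kappa.
Local Notation leb := (@lebesgue_measure R).
Local Notation U := (@uniform_prob R 0 1 ltr01).
Local Notation Pr := (radial_law P).
Local Notation X := (@moving_cluster R d dO O C kappa alpha).
Local Notation M := (moving_measure d P).
Local Notation site_sum := (@site_sum R d dO O C kappa alpha).

Lemma integral_radial_law (f : O * R -> \bar R) : measurable_fun setT f ->
  (forall y, 0 <= f y)%E ->
  (\int[Pr]_y f y = \int[P]_w \int[leb]_(s in `]0%R, 1%R[) f (w, s))%E.
Proof.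
move=> mf f0; rewrite (@fubini_tonelli1 _ _ _ _ _ P U f mf f0).
apply: eq_integral => w _; rewrite /fubini_F integral_uniform01//.
exact: (measurableT_comp mf (pair1_measurable w)).
Qed.

Let mass : \bar R := M setT.

Let site_sum1 y : site_sum (cst 1%E) y =
  (if 0 < y.2 <= 1 then period_size R d (level d y.2) else 0)%:E.
Proof.
rewrite /site_sum; case: ifP => // _.
exact: esum_box_card.
Qed.

Let size_at (s : R) : \bar R :=
  (if 0 < s <= 1 then period_size R d (level d s) else 0)%:E.

Let size_at_ge0 s : (0 <= size_at s)%E.
Proof. by rewrite lee_fin; case: ifP => // _; exact: ltW (period_size_gt0 _ _ _). Qed.

Let measurable_size_at : measurable_fun setT size_at.
Proof.
rewrite (_ : size_at = fun s => site_sum (cst 1%E) (point, s)).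
  apply: (measurableT_comp _ (pair1_measurable point)).
  by apply: measurable_site_sum => //; exact: measurable_cst.
by apply/funext => s; rewrite site_sum1.
Qed.

Let massE : mass = (\int[leb]_(s in `]0%R, 1%R[) size_at s)%E.
Proof.
rewrite /mass -[M setT]mul1e -integral_cst//.
rewrite -[LHS]/(\int[M]_z (cst 1 (X z)))%E.
rewrite (integral_moving_cluster P alpha C_l0 kappa_meas)//.
rewrite integral_radial_law.
- rewrite (eq_integral (cst (\int[leb]_(s in `]0%R, 1%R[) size_at s)%E)).
    by rewrite integral_cst// [X in (_ * X)%E](probability_setT P) mule1.
  by move=> w _; apply: eq_integral => s _; rewrite site_sum1.
- by apply: measurable_site_sum => //; exact: measurable_cst.
- by move=> y; exact: site_sum_ge0.
Qed.

Let mass_gt0 : (0 < mass)%E.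
Proof.
rewrite massE; apply: (@lt_le_trans _ _ 1%E) => //.
apply: (@le_trans _ _ (\int[leb]_(s in `]0%R, 1%R[) 1)%E).
  rewrite integral_cst//= mul1e.
  rewrite -[leRHS]/(lebesgue_measure `]0, 1[%classic).
  by rewrite lebesgue_measure_itv/= lte_fin ltr01 -EFinB subr0.
apply: ge0_le_integral => //.
  by apply: measurable_funTS; exact: measurable_size_at.
move=> s; rewrite /= in_itv/= => /andP[s0 s1].
by rewrite /size_at s0 (ltW s1)/= lee_fin period_sizeE ler1n expn_gt0.
Qed.

(** The heights of level [m] fill an interval no longer than the threshold of
    [m], and their periods have [period_size m] sites: together at most [2^-m]. *)
Let mass_lty : (mass < +oo)%E.
Proof.
pose h m (s : R) : \bar R :=
  ((period_size R d m)%:E * (\1_(`]0%R, period_threshold R d m]%classic) s)%:E)%E.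
have h0 m s : (0 <= h m s)%E.
  by rewrite mule_ge0// lee_fin// ltW// period_size_gt0.
have mh m : measurable_fun setT (h m).
  apply: emeasurable_funM => //; apply/measurable_EFinP.
  exact: measurable_indic.
rewrite massE; apply: (@le_lt_trans _ _
    (\int[leb]_s \esum_(m in [set: nat]) h m s)%E).
  rewrite integral_mkcond; apply: ge0_le_integral => //.
  - by move=> s _; rewrite patchE; case: ifP.
  - by apply/(measurable_restrictT _ _).1 => //; exact: measurable_funTS.
  - exact: measurable_esum.
  move=> s _; rewrite patchE; case: ifPn => [|_]; last exact: esum_ge0.
  rewrite inE/= in_itv/= => /andP[s0 s1].
  have ss : 0 < s <= 1 by rewrite s0 ltW.
  apply: le_trans (esum_ge1 (level d s) (fun m => h0 m s)).
  rewrite /size_at ss /h indicE mem_set ?mule1//.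
  by rewrite /= in_itv/= s0 le_threshold_level.
rewrite integral_esum// -nneseries_esumT; last first.
  by move=> m; apply: integral_ge0 => s _; exact: h0.
apply: (@le_lt_trans _ _ 2%:E); last exact: ltry.
apply: le_trans (@epsilon_trick0 R 2 xpredT _) => //.
apply: lee_nneseries => [m _ _|m _].
  by apply: integral_ge0 => s _; exact: h0.
rewrite /h ge0_integralZl_EFin//; last first.
  by apply/measurable_EFinP; exact: measurable_indic.
rewrite integral_indic// setIT.
rewrite -[X in (_ * X)%E]/(lebesgue_measure `]0, period_threshold R d m]%classic).
rewrite lebesgue_measure_itv/= lte_fin period_threshold_gt0 -EFinB subr0 -EFinM lee_fin.
rewrite /period_threshold invfM mulrCA divff ?mulr1 ?gt_eqF ?period_size_gt0//.
by rewrite expnS natrM invfM mulrA divff// mul1r natrX.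
Qed.

Definition moving_law : probability ((O * measurableTypeR R) * nat)%type R :=
  mnormalize M (@dirac _ _ point R).

Definition moving_weight : R := (fine mass)^-1.

Lemma moving_weight_gt0 : 0 < moving_weight.
Proof. by rewrite invr_gt0 fine_gt0// mass_gt0 mass_lty. Qed.

Lemma integral_moving_law (g : Zdfield R d -> \bar R) :
  measurable_fun setT g -> (forall x, 0 <= g x)%E ->
  (\int[moving_law]_z g (X z) = moving_weight%:E * \int[Pr]_y site_sum g y)%E.
Proof.
move=> mg g0; pose m := mscale (NngNum (ltW moving_weight_gt0)) M.
rewrite (eq_measure_integral m); last first.
  move=> A mA _; rewrite /moving_law /= /mnormalize -/mass.
  by rewrite gt_eqF// lt_eqF//= muleC.
have mgX : measurable_fun setT (fun z : (O * measurableTypeR R) * nat => g (X z)).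
  exact: measurableT_comp mg (measurable_moving_cluster alpha C_l0 kappa_meas).
rewrite ge0_integral_mscale//; apply: (congr1 (mule _)).
exact: (integral_moving_cluster P alpha C_l0 kappa_meas mg g0).
Qed.

Lemma site_sum_fshift (g : Zdfield R d -> \bar R) k y :
  site_sum (g \o fshift k) y = site_sum g y.
Proof.
rewrite /site_sum; case: ifP => // _.
exact: (esum_periodised_shift _ g (pareto alpha y.2 * kappa y.1) (C y.1) k).
Qed.

Lemma moving_stationary : stationary moving_law X.
Proof.
split; first exact: (measurable_moving_cluster alpha C_l0 kappa_meas).
move=> k B mB.
have mX := measurable_moving_cluster alpha C_l0 kappa_meas.
have E (B0 : set (Zdfield R d)) : measurable B0 ->
    moving_law (X @^-1` B0) =
    (moving_weight%:E * \int[Pr]_y site_sum (fun x => (\1_B0 x)%:E) y)%E.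
  move=> mB0; rewrite -integral_moving_law//.
  - rewrite -[in LHS](setIT (X @^-1` B0)) -integral_indic//.
    by rewrite -[X in measurable X]setTI; exact: mX.
  - by apply/measurable_EFinP; exact: measurable_indic.
have mkB : measurable (@fshift R d k @^-1` B).
  by rewrite -[X in measurable X]setTI; exact: measurable_fshift.
apply: (eq_trans (E _ mB)); apply/esym; apply: (eq_trans (E _ mkB)).
apply: (congr1 (mule _)); apply: eq_integral => y _.
exact: (site_sum_fshift (fun x => (\1_B x)%:E) k y).
Qed.

End MovingField.

Section RegularVariation.
Context (R : realType) (d : nat).
Context (dO : measure_display) (O : measurableType dO) (P : probability O R).
Context (C : O -> Zdfield R d) (kappa : O -> R) (alpha c : R).
Hypothesis C_l0 : random_element_l0 C.
Hypothesis alpha_gt0 : 0 < alpha.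
Hypothesis kappa_meas : measurable_fun setT kappa.
Hypothesis kappa_sign : forall w, kappa w = -1 \/ kappa w = 1.
Local Notation leb := (@lebesgue_measure R).
Local Notation Pr := (radial_law P).
Local Notation V := (pareto alpha).
Local Notation site_sum := (@site_sum R d dO O C kappa alpha).
Local Notation ray_sum := (ray_sum C kappa alpha).

(** The period sum at height [b^-1], in the radial variable of [ray_sum]. *)
Definition scaled_site_sum (b : R) (f : Zdfield R d -> R) (y : O * R) : \bar R :=
  if b `^ alpha * y.2 < 1
  then site_sum (fun x => (f (fscale b x))%:E) (y.1, b `^ alpha * y.2) else 0%E.

Lemma scaled_site_sum_ge0 b (f : Zdfield R d -> R) y : (forall x, 0 <= f x) ->
  (0 <= scaled_site_sum b f y)%E.
Proof.
move=> f0; rewrite /scaled_site_sum; case: ifP => // _.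
by apply: site_sum_ge0 => x; rewrite lee_fin.
Qed.

Let measurable_f_scaled b (f : Zdfield R d -> R) : measurable_fun setT f ->
  measurable_fun setT (fun x => (f (fscale b x))%:E).
Proof.
move=> mf; apply/measurable_EFinP; apply: (measurableT_comp mf).
exact: (measurable_fscale (measurable_cst b) (@measurable_id _ _ _)).
Qed.

Lemma measurable_scaled_site_sum b (f : Zdfield R d -> R) :
  measurable_fun setT f -> (forall x, 0 <= f x) ->
  measurable_fun setT (scaled_site_sum b f).
Proof.
move=> mf f0; have m2 : measurable_fun setT (fun y : O * R => b `^ alpha * y.2).
  by apply: measurable_funM => //; exact: measurable_snd.
apply: measurable_fun_if0; first exact: measurable_ltr.
have ms : measurable_fun setT (site_sum (fun x => (f (fscale b x))%:E)).
  apply: measurable_site_sum => //; last by move=> x; rewrite lee_fin.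
  exact: (measurable_f_scaled b mf).
apply: (measurableT_comp ms); apply: measurable_fun_pair => //.
Qed.

(** Scaling the field by [b] amounts to scaling the radial variable by
    [b^alpha]. *)
Lemma integral_site_sum_fscale b (f : Zdfield R d -> R) : 0 < b ->
  measurable_fun setT f -> (forall x, 0 <= f x) ->
  (\int[Pr]_y site_sum (fun x => (f (fscale b x))%:E) y =
   (b `^ alpha)%:E * \int[P \x leb]_y scaled_site_sum b f y)%E.
Proof.
move=> b0 mf f0; pose g x := (f (fscale b x))%:E.
have g0 x : (0 <= g x)%E by rewrite lee_fin.
have mg : measurable_fun setT g := measurable_f_scaled b mf.
have ms : measurable_fun setT (site_sum g) by apply: measurable_site_sum.
have s0 y : (0 <= site_sum g y)%E by apply: site_sum_ge0.
rewrite integral_radial_law//.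
rewrite (@fubini_tonelli1 _ _ _ _ _ P leb _ (measurable_scaled_site_sum b mf f0)
  (fun y => scaled_site_sum_ge0 b y f0)).
rewrite -ge0_integralZl_EFin //; last 3 first.
- by move=> w _; apply: integral_ge0 => r _; exact: scaled_site_sum_ge0.
- apply: (@measurable_fun_fubini_tonelli_F _ _ O (measurableTypeR R) R leb).
    exact: measurable_scaled_site_sum.
  by move=> y; exact: scaled_site_sum_ge0.
- exact: powR_ge0.
apply: eq_integral => w _; rewrite /fubini_F.
pose h (s : R) : \bar R := if s < 1 then site_sum g (w, s) else 0%E.
have mh : measurable_fun setT h.
  apply: measurable_fun_if0; first exact: measurable_ltr.
  exact: (measurableT_comp ms (pair1_measurable w)).
have h0 s : (0 <= h s)%E by rewrite /h; case: ifP.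
rewrite [RHS](@integral_lebesgue_scale R (b `^ alpha) h)//; last exact: powR_gt0.
rewrite integral_mkcond; apply: eq_integral => s _; rewrite patchE /h.
case: ifPn; first by rewrite inE/= in_itv/= => /andP[_ ->].
rewrite notin_setE/= in_itv/= => /negP; rewrite negb_and => /orP[s1|/negbTE-> //].
case: ifP => // _; rewrite /site_sum/=.
by rewrite (negbTE s1).
Qed.

Section Test.
Variables (f : Zdfield R d -> R) (B : R) (m0 : nat).
Hypothesis mf : measurable_fun setT f.
Hypothesis f0 : forall x, 0 <= f x.
Hypothesis fB : forall x, f x <= B.
Hypothesis f1 : forall x, `|x 0| <= 1 -> f x = 0.
Hypothesis flocal : forall x y,
  (forall i, (absZ i <= m0)%N -> x i = y i) -> f x = f y.

Let B0 : 0 <= B. Proof. exact: le_trans (f0 (fun=> 0)) (fB _). Qed.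

Let scaled_site_sumE b w r : 0 < b -> 0 < r -> b `^ alpha * r < 1 ->
  let N := level d (b `^ alpha * r) in
  scaled_site_sum b f (w, r) =
  (\esum_(j in [set: Zd d]) (if (absZ j <= N)%N
     then (f (fscale (V r * kappa w) (fshift j (periodised N (C w)))))%:E
     else 0))%E.
Proof.
move=> b0 r0 br N; have br0 : 0 < b `^ alpha * r by rewrite mulr_gt0// powR_gt0.
rewrite /scaled_site_sum/= br /site_sum/= br0 (ltW br)/=.
apply: eq_esum => j _; case: ifP => // _; congr (f _)%:E.
rewrite /placed_cluster/= fscaleA pareto_scale//; congr fscale.
by rewrite mulrA [b * _]mulrC divfK ?gt_eqF.
Qed.

Let cluster0 w r j : 0 < r -> (`|fscale (V r * kappa w) (fshift j (C w)) 0| <= 1) =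
  ~~ (r < `|C w j| `^ alpha).
Proof.
move=> r0; rewrite -pareto_gt1// -leNgt /fscale /fshift add0r.
by rewrite !normrM (kappa_norm kappa_sign) mulr1 gtr0_norm ?pareto_gt0.
Qed.

(** Inside the period the periodised cluster agrees with [C] at the site that is
    moved to the origin, so no more sites are visible than in [ray_sum]. *)
Let scaled_site_sum_le b y : 0 < b ->
  (scaled_site_sum b f y <= B%:E * ray_sum (cst 1%R) y)%E.
Proof.
case: y => w r b0; have ray0 : (0 <= B%:E * ray_sum (cst 1%R) (w, r))%E.
  by rewrite mule_ge0// ray_sum_ge0// => x; exact: ler01.
have [br|br] := ltP (b `^ alpha * r) 1; last first.
  by rewrite /scaled_site_sum/= ltNge br.
have [r0|r0] := ltP 0 r; last first.
  rewrite /scaled_site_sum/= br /site_sum/= pmulr_rgt0 ?powR_gt0//.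
  by rewrite ltNge r0.
rewrite scaled_site_sumE// /ray_sum -esumZl//; last first.
  by move=> k; rewrite lee_fin ray_term_ge0// => x; exact: ler01.
apply: le_esum => j _; rewrite /ray_term/= r0/=.
case: ifP => [jN|_]; last by rewrite -EFinM lee_fin mulr_ge0//; case: ifP.
rewrite -EFinM lee_fin; case: ifPn => [_|jC]; first by rewrite mulr1.
rewrite f1 ?mulr0// -[leLHS]/(`|V r * kappa w * periodised _ _ (0 + j)|) add0r.
rewrite /periodised wrapK//; move: (cluster0 w j r0).
by rewrite /fscale /fshift add0r jC.
Qed.

(** In [l0] only finitely many sites of the cluster are visible at radius [r],
    and all windows around them fit into one period once the period is large. *)
Lemma scaled_site_sum_near (b : nat -> R) w r : (forall n, 0 < b n) ->
  b n @[n --> \oo] --> 0 ->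
  \forall n \near \oo, scaled_site_sum (b n) f (w, r) = ray_sum f (w, r).
Proof.
move=> b0 b_lim; have [r0|r0] := ltP 0 r; last first.
  apply: nearW => n; rewrite /scaled_site_sum /ray_sum /site_sum /ray_sum/=.
  rewrite pmulr_rgt0 ?powR_gt0// [0 < r]ltNge r0/= if_same esum1// => k _.
  by rewrite /ray_term/= ltNge r0.
have small t : 0 < t -> \forall n \near \oo, b n `^ alpha * r < t.
  move=> t0; have tr : 0 < t / r by rewrite divr_gt0.
  have q0 : 0 < (t / r) `^ alpha^-1 by rewrite powR_gt0.
  near=> n; rewrite -ltr_pdivlMr//.
  have -> : t / r = ((t / r) `^ alpha^-1) `^ alpha.
    by rewrite -powRrM mulVf ?lt0r_neq0// powRr1 ?ltW.
  rewrite ltr_powR_mono ?ltW//; near: n.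
  apply: filterS (cvgr0_norm_lt b b_lim _ q0) => n.
  by rewrite gtr0_norm.
have [L CL] : exists L, forall j, r < `|C w j| `^ alpha -> (absZ j <= L)%N.
  have [L CL] := C_l0.2 w (r `^ alpha^-1) (powR_gt0 _ r0).
  exists L => j; rewrite leqNgt; apply: contraL => /ltnW/CL h; rewrite -leNgt.
  have -> : r = (r `^ alpha^-1) `^ alpha.
    by rewrite -powRrM mulVf ?lt0r_neq0// powRr1 ?ltW.
  by rewrite ge0_ler_powR ?nnegrE ?powR_ge0 ?(ltW alpha_gt0) ?(ltW h).
near=> n.
have s1 : b n `^ alpha * r < 1 by near: n; exact: small.
have sL : b n `^ alpha * r < period_threshold R d (L + m0).
  by near: n; apply: small; exact: period_threshold_gt0.
rewrite scaled_site_sumE//; set N := level _ _.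
have LN : (L + m0 <= N)%N.
  by apply: level_ge; rewrite mulr_gt0 ?powR_gt0//= ltW.
apply: eq_esum => j _; rewrite /ray_term/= r0/=; case: ifPn => [jN|jN].
  case: ifPn => jC.
    congr EFin; apply: flocal => i im; congr (_ * _); rewrite /fshift /periodised.
    rewrite wrapK// (leq_trans (absZD _ _))// addnC (leq_trans _ LN)//.
    by rewrite leq_add// CL.
  rewrite f1// -[leLHS]/(`|V r * kappa w * periodised _ _ (0 + j)|) add0r.
  rewrite /periodised wrapK//; move: (cluster0 w j r0).
  by rewrite /fscale /fshift add0r jC.
case: ifPn => // /CL jL; move: jN; rewrite (leq_trans jL)// (leq_trans _ LN)//.
exact: leq_addr.
Unshelve. all: by end_near. Qed.

Hypothesis ray_mass : (\int[P \x leb]_y ray_sum (cst 1%R) y < +oo)%E.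

Lemma cvg_integral_scaled_site_sum (b : nat -> R) : (forall n, 0 < b n) ->
  b n @[n --> \oo] --> 0 ->
  (\int[P \x leb]_y scaled_site_sum (b n) f y @[n --> \oo] -->
   \int[P \x leb]_y ray_sum f y)%E.
Proof.
move=> b0 b_lim.
have m1 : measurable_fun setT (ray_sum (cst 1%R)).
  by apply: measurable_ray_sum => // x; exact: ler01.
have p1 y : (0 <= ray_sum (cst 1%R) y)%E.
  by apply: ray_sum_ge0 => x; exact: ler01.
have [] := @dominated_convergence _ _ _ (P \x leb)%E setT measurableT
  (fun n => scaled_site_sum (b n) f) (ray_sum f)
  (fun y => B%:E * ray_sum (cst 1%R) y)%E _ _ _ _ _.
- by move=> n; exact: measurable_scaled_site_sum.
- exact: measurable_ray_sum.
- apply: aeW => -[w r] _; apply: cvg_near_cst.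
  exact: scaled_site_sum_near.
- apply: integrableZl => //; apply/integrableP; split => //.
  by under eq_integral do rewrite gee0_abs//.
- apply: aeW => y n _; rewrite gee0_abs; first exact: scaled_site_sum_le.
  exact: scaled_site_sum_ge0.
by [].
Qed.

End Test.
End RegularVariation.

(** * Realising the mixture as a spectral tail process *)

Section ParetoMultiple.
Context (R : realType) (d : nat).
Context (dO : measure_display) (O : measurableType dO) (P : probability O R).
Context (C : O -> Zdfield R d) (kappa : O -> R) (alpha c : R).
Hypothesis C_l0 : random_element_l0 C.
Hypothesis alpha_gt0 : 0 < alpha.
Hypothesis c_gt0 : 0 < c.
Hypothesis kappa_meas : measurable_fun setT kappa.
Hypothesis kappa_sign : forall w, kappa w = -1 \/ kappa w = 1.
Context (dT : measure_display) (OT : measurableType dT) (PT : probability OT R).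
Context (Theta : OT -> Zdfield R d).
Hypothesis Theta_l0 : random_element_l0 Theta.
Hypothesis mix : mixture_representation P C kappa alpha c PT Theta.
Local Notation leb := (@lebesgue_measure R).
Local Notation U := (@uniform_prob R 0 1 ltr01).
Local Notation V := (pareto alpha).
Local Notation ray_sum := (ray_sum C kappa alpha).
Local Notation PY := (radial_law PT).

(** The tail process whose spectral part is [Theta]. *)
Definition pareto_multiple (z : OT * R) : Zdfield R d :=
  fscale (V z.2) (Theta z.1).

Lemma measurable_pareto_multiple : measurable_fun setT pareto_multiple.
Proof.
apply: measurable_fscale.
  exact: (measurableT_comp (measurable_pareto alpha) measurable_snd).
exact: (measurableT_comp Theta_l0.1 measurable_fst).
Qed.

Lemma integral_pareto_multiple (g : Zdfield R d -> R) :
  measurable_fun setT g -> (forall x, 0 <= g x) ->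
  (\int[PY]_z (g (pareto_multiple z))%:E =
   (c^-1)%:E * \int[P \x leb]_z ray_sum g z)%E.
Proof.
move=> mg g0.
rewrite -(pareto_mixture C_l0 alpha_gt0 c_gt0 kappa_meas Theta_l0 mix mg g0).
have mgY : measurable_fun setT
    (fun z : OT * measurableTypeR R => (g (pareto_multiple z))%:E).
  apply/measurable_EFinP.
  exact: measurableT_comp mg measurable_pareto_multiple.
have gY0 (z : OT * R) : (0 <= (g (pareto_multiple z))%:E)%E by rewrite lee_fin.
rewrite (@fubini_tonelli2 _ _ _ _ _ PT U _ mgY gY0).
rewrite integral_uniform01//.
- apply: (@measurable_fun_fubini_tonelli_G _ _ OT (measurableTypeR R) R PT) => //.
- by move=> r; apply: integral_ge0 => t _; exact: gY0.
Qed.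

Lemma ray_mass : (\int[P \x leb]_z ray_sum (cst 1%R) z)%E = c%:E.
Proof.
have : (\int[PY]_z (cst 1%E z) = (c^-1)%:E * \int[P \x leb]_z ray_sum (cst 1%R) z)%E.
  exact: integral_pareto_multiple (measurable_cst _) (fun=> ler01).
rewrite integral_cst// [X in (_ * X)%E](probability_setT PY) mul1e => h.
rewrite -[LHS]mul1e -[X in (X%:E * _)%E](mulfV (lt0r_neq0 c_gt0)) EFinM -muleA -h.
by rewrite mule1.
Qed.

Let modulus1 := [set t | `|Theta t 0| == 1].

Let measurable_modulus : measurable_fun setT (fun t => `|Theta t 0|).
Proof.
apply: measurableT_comp => //.
exact: (measurableT_comp (measurable_coord 0) Theta_l0.1).
Qed.

Let measurable_modulus1 : measurable modulus1.
Proof.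
have := measurable_modulus measurableT (measurable_set1 (1 : R)); rewrite setTI.
by congr measurable; apply/seteqP; split => t /eqP.
Qed.

(** Each rescaled cluster of the mixture is divided by its modulus at the site
    that is moved to the origin. *)
Let prob_modulus1 : PT modulus1 = 1%E.
Proof.
pose S := [set x : Zdfield R d | `|x 0| != 1].
have mS : measurable S.
  have m0 : measurable_fun setT (fun x : Zdfield R d => `|x 0|).
    by apply: measurableT_comp => //; exact: measurable_coord.
  have := m0 measurableT (~` [set 1]) (measurableC (measurable_set1 _)).
  rewrite setTI; congr measurable; apply/seteqP; split => x /=.
    by move=> /eqP.
  by move=> /eqP.
have S0 : PT (~` modulus1) = 0%E.
  have : ('E_PT[\1_S \o Theta] = 0)%E.
    rewrite mix; last by split=> [|x _] //; exact: measurable_funTS.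
    rewrite integral0_eq ?mule0// => w _; rewrite esum1// => k _.
    case: eqP => // /eqP Ck; rewrite indicE memNset ?mul0r//= => /eqP; apply.
    rewrite /fscale /fshift add0r !normrM (kappa_norm kappa_sign) mul1r.
    by rewrite normfV normr_id mulVf// normr_eq0.
  rewrite unlock => <-; rewrite -[in LHS](setIT (~` _)) -integral_indic//.
    apply: eq_integral => t _; congr EFin; rewrite !indicE; congr (nat_of_bool _)%:R.
    by apply/idP/idP; rewrite !inE => /= /negP.
  exact: measurableC.
have := probability_setC PT measurable_modulus1; rewrite S0 => /esym/eqP.
by rewrite sube_eq ?fin_num_measure// ?add0e => /eqP <-.
Qed.

Let polar_event (A : set OT) (y : R) : measurable A ->
  PY [set z | (A `&` modulus1) z.1 /\ y < V z.2] =
  (PT A * (if 1 <= y then y `^ (- alpha) else 1)%:E)%E.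
Proof.
move=> mA; rewrite -(uniform_pareto_gt alpha_gt0 y).
rewrite -(probability_setI_one mA measurable_modulus1 prob_modulus1).
rewrite setIC; apply: product_measure1E; first exact: measurableI.
exact: measurable_ltr (measurable_cst y) (measurable_pareto alpha).
Qed.

Let polar := [set z : OT * R | (setT `&` modulus1) z.1 /\ 0 < V z.2].

Let measurable_polar_event (A : set OT) (y : R) : measurable A ->
  measurable ([set z | (A `&` modulus1) z.1 /\ y < V z.2] : set (OT * measurableTypeR R)).
Proof.
move=> mA; rewrite -[X in measurable X]/((A `&` modulus1) `*` [set r | y < V r]).
apply: measurableX; first exact: measurableI.
exact: measurable_ltr (measurable_cst y) (measurable_pareto alpha).
Qed.

(** Almost surely [Theta] has modulus 1 at the origin and the radius is positive,
    where the polar coordinates of [pareto_multiple] are read off. *)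
Let prob_polar (A : set (OT * measurableTypeR R)) : measurable A ->
  PY A = PY (polar `&` A).
Proof.
move=> mA; rewrite probability_setI_one//; first exact: measurable_polar_event.
by rewrite polar_event// ler10 probability_setT mul1e.
Qed.

Lemma pareto_multiple_tail_index : tail_index PY pareto_multiple alpha.
Proof.
move=> y y1; have y0 : 0 < y := lt_le_trans ltr01 y1.
rewrite prob_polar; last first.
  rewrite -[X in measurable X]setTI.
  exact: (measurable_pareto_multiple measurableT (measurable_coord_gt 0 y)).
transitivity (PY [set z | (setT `&` modulus1) z.1 /\ y < V z.2]); last first.
  by rewrite polar_event// y1 probability_setT mul1e.
congr (PY _); apply/seteqP; split => z /=.
  move=> [[[_ /eqP m1] V0]]; rewrite /pareto_multiple /fscale normrM m1 mulr1.
  by rewrite gtr0_norm// => yV; split => //; split => //; exact/eqP.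
move=> [[_ m1] yV]; have V0 := lt_trans y0 yV; split => //.
by rewrite /pareto_multiple /fscale normrM (eqP m1) mulr1 gtr0_norm.
Qed.

Lemma pareto_multiple_spectral : same_law PT Theta PY (@spectral R d \o pareto_multiple).
Proof.
move=> B mB; have mTB : measurable (Theta @^-1` B).
  by rewrite -[X in measurable X]setTI; exact: Theta_l0.1.
rewrite prob_polar; last first.
  rewrite -[X in measurable X]setTI.
  exact: (measurableT_comp (@measurable_spectral R d) measurable_pareto_multiple).
transitivity (PY [set z | (Theta @^-1` B `&` modulus1) z.1 /\ 0 < V z.2]).
  by rewrite polar_event// ler10 mule1.
have E (z : OT * R) : modulus1 z.1 -> 0 < V z.2 ->
    spectral (pareto_multiple z) = Theta z.1.
  move=> /eqP m1 V0; rewrite /pareto_multiple spectral_fscale//.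
  by rewrite /spectral m1 invr1 fscale1.
congr (PY _); apply/seteqP; split => z /=.
  by move=> [[BT m1] V0]; split => //; rewrite E.
by move=> [[[_ m1] V0]]; rewrite E.
Qed.

End ParetoMultiple.

Section Shift.
Context (R : realType) (dT : measure_display) (T : measurableType dT).
Context (mu : probability T R) (D : set T) (mD : measurable D).

Lemma Rintegral_shift (f : T -> R) (K : R) : measurable_fun setT f ->
  (forall t, `|f t| <= K) ->
  \int[mu]_(t in D) f t = \int[mu]_(t in D) (f t + K) - K * fine (mu D).
Proof.
move=> mf fK; have muD : (mu D < +oo)%E by rewrite ltey_eq fin_num_measure.
rewrite RintegralD//; last 2 first.
- apply: measurable_bounded_integrable => //; first exact: measurable_funTS.
  by exists K; split => [|M KM t _]; [exact: num_real|exact: le_trans (ltW KM)].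
- apply: measurable_bounded_integrable => //.
  by exists `|K|; split => [|M KM t _]; [exact: num_real|exact: ltW].
by rewrite Rintegral_cst// addrK.
Qed.

End Shift.

Section MovingTail.
Context (R : realType) (d : nat).
Context (dO : measure_display) (O : measurableType dO) (P : probability O R).
Context (C : O -> Zdfield R d) (kappa : O -> R) (alpha c : R).
Hypothesis C_l0 : random_element_l0 C.
Hypothesis alpha_gt0 : 0 < alpha.
Hypothesis c_gt0 : 0 < c.
Hypothesis kappa_meas : measurable_fun setT kappa.
Hypothesis kappa_sign : forall w, kappa w = -1 \/ kappa w = 1.
Context (dT : measure_display) (OT : measurableType dT) (PT : probability OT R).
Context (Theta : OT -> Zdfield R d).
Hypothesis Theta_l0 : random_element_l0 Theta.
Hypothesis mix : mixture_representation P C kappa alpha c PT Theta.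
Local Notation leb := (@lebesgue_measure R).
Local Notation ray_sum := (ray_sum C kappa alpha).
Local Notation scaled_site_sum := (scaled_site_sum C kappa alpha).
Local Notation X := (moving_cluster C kappa alpha).
Local Notation PX := (moving_law d P).
Local Notation Y := (pareto_multiple alpha Theta).
Local Notation PY := (radial_law PT).
Local Notation far u := [set z | u < `|X z 0|].

Let mX : measurable_fun setT (X : (O * measurableTypeR R) * nat -> Zdfield R d).
Proof. exact: (measurable_moving_cluster alpha C_l0 kappa_meas). Qed.

Let mY : measurable_fun setT (Y : OT * measurableTypeR R -> Zdfield R d).
Proof. exact: (measurable_pareto_multiple alpha Theta_l0). Qed.

Let measurable_far u : measurable (far u : set ((O * measurableTypeR R) * nat)).
Proof.
by rewrite -[X in measurable X]setTI; exact: (mX measurableT (measurable_coord_gt 0 u)).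
Qed.

Let Y0_gt1 : PY [set z | 1 < `|Y z 0|] = 1%E.
Proof.
rewrite (pareto_multiple_tail_index alpha_gt0 kappa_sign Theta_l0 mix)//.
by rewrite powR1.
Qed.

(** The conditioning event, absorbed into the observable. *)
Let visible (g : Zdfield R d -> R) (x : Zdfield R d) : R :=
  if 1 < `|x 0| then g x else 0.

Let measurable_visible g : measurable_fun setT g -> measurable_fun setT (visible g).
Proof. by apply: measurable_fun_if0; exact: measurable_coord_gt. Qed.

Let visible_ge0 (g : Zdfield R d -> R) x : (forall x, 0 <= g x) -> 0 <= visible g x.
Proof. by move=> g0; rewrite /visible; case: ifP. Qed.

Let integral_visible (g : Zdfield R d -> R) :
  measurable_fun setT g -> (forall x, 0 <= g x) ->
  (\int[PY]_z (visible g (Y z))%:E = \int[PY]_z (g (Y z))%:E)%E.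
Proof.
move=> mg g0; have mD : measurable ([set z | 1 < `|Y z 0|] : set (OT * measurableTypeR R)).
  by rewrite -[X in measurable X]setTI; exact: (mY measurableT (measurable_coord_gt 0 1)).
have D0 : PY (~` [set z | 1 < `|Y z 0|]) = 0%E.
  by rewrite probability_setC// Y0_gt1 subee.
have mgY (h : Zdfield R d -> R) : measurable_fun setT h ->
    measurable_fun setT (fun z : OT * measurableTypeR R => (h (Y z))%:E).
  by move=> mh; apply/measurable_EFinP; exact: measurableT_comp mh mY.
rewrite (ge0_negligible_integral (measurableC mD) _ (mgY _ (measurable_visible mg)))//; last first.
  by move=> z _; rewrite lee_fin visible_ge0.
rewrite [RHS](ge0_negligible_integral (measurableC mD) _ (mgY _ mg))//; last first.
  by move=> z _; rewrite lee_fin.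
apply: eq_integral => z; rewrite setTD setCK inE/= => z1.
by rewrite /visible z1.
Qed.

Let mw_gt0 : 0 < moving_weight d P := moving_weight_gt0 P alpha C_l0 kappa_meas.

(** Seen from a site at height above [u], the field scaled by [u^-1] is a
    scaled cluster; the power of [u] is common to all observables. *)
Let integral_far (g : Zdfield R d -> R) u : 0 < u -> measurable_fun setT g ->
  (forall x, 0 <= g x) ->
  \int[PX]_(z in far u) g (fscale u^-1 (X z)) =
  moving_weight d P * u^-1 `^ alpha *
    fine (\int[P \x leb]_y scaled_site_sum u^-1 (visible g) y)%E.
Proof.
move=> u0 mg g0; have v0 : 0 < u^-1 by rewrite invr_gt0.
have mv := measurable_visible mg.
have p0 x : 0 <= visible g x := visible_ge0 x g0.
have mvs : measurable_fun setT (fun x => (visible g (fscale u^-1 x))%:E).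
  apply/measurable_EFinP; apply: (measurableT_comp mv).
  exact: (measurable_fscale (measurable_cst u^-1) (@measurable_id _ _ _)).
have fineZ (a : R) (x : \bar R) : 0 < a -> fine (a%:E * x) = a * fine x.
  by move=> a0; case: x => [x| |]//=; rewrite ?gt0_muley ?gt0_muleNy ?lte_fin// mulr0.
rewrite -!mulrA -!fineZ ?mw_gt0 ?powR_gt0//; rewrite /Rintegral; congr fine.
rewrite -(integral_site_sum_fscale P alpha C_l0 kappa_meas v0 mv p0).
rewrite -(integral_moving_law P alpha C_l0 kappa_meas mvs); last first.
  by move=> x; rewrite lee_fin.
rewrite integral_mkcond; apply: eq_integral => z _; rewrite patchE /visible.
rewrite [in RHS]/fscale normrM gtr0_norm// ltr_pdivlMl// mulr1.
case: ifPn; first by rewrite inE/= => ->.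
by rewrite notin_setE/= => /negP/negbTE->.
Qed.

Let cvg_visible (g : Zdfield R d -> R) (B : R) (m0 : nat) (b : nat -> R) :
  measurable_fun setT g -> (forall x, 0 <= g x) -> (forall x, g x <= B) ->
  (forall x y, (forall i, (absZ i <= m0)%N -> x i = y i) -> g x = g y) ->
  (forall n, 0 < b n) -> b n @[n --> \oo] --> 0 ->
  fine (\int[P \x leb]_y scaled_site_sum (b n) (visible g) y)%E @[n --> \oo] -->
  c * \int[PY]_z g (Y z).
Proof.
move=> mg g0 gB glocal b0 b_lim.
have mv := measurable_visible mg.
have p0 x : 0 <= visible g x := visible_ge0 x g0.
have B0 : 0 <= B := le_trans (g0 (fun=> 0)) (gB _).
have gfin : (\int[PY]_z (g (Y z))%:E)%E \is a fin_num.
  rewrite ge0_fin_numE; last by apply: integral_ge0 => z _; rewrite lee_fin.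
  apply: (@le_lt_trans _ _ (\int[PY]_z (cst B%:E z))%E); last first.
    by rewrite integral_cst// [X in (_ * X)%E](probability_setT PY) mule1 ltry.
  apply: ge0_le_integral => //.
  - by move=> z _; rewrite lee_fin.
  - by apply/measurable_EFinP; exact: measurableT_comp mg mY.
  - by move=> z _; rewrite lee_fin.
apply: fine_cvg.
have -> : (c * \int[PY]_z g (Y z))%:E = (\int[P \x leb]_y ray_sum (visible g) y)%E.
  rewrite EFinM fineK// -integral_visible//.
  rewrite (integral_pareto_multiple C_l0 alpha_gt0 c_gt0 kappa_meas Theta_l0 mix mv p0).
  by rewrite muleA -EFinM mulfV ?mul1e// lt0r_neq0.
apply: (@cvg_integral_scaled_site_sum _ _ _ _ _ _ _ _ C_l0 alpha_gt0 kappa_meas kappa_sign _ B m0) => //.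
- by move=> x; rewrite /visible; case: ifP.
- by move=> x; rewrite /visible ltNge => ->.
- move=> x y xy; rewrite /visible -xy; last by rewrite /absZ big1// => k _; rewrite mxE.
  by case: ifP => // _; exact: glocal.
rewrite (ray_mass C_l0 alpha_gt0 c_gt0 kappa_meas Theta_l0 mix).
exact: ltry.
Qed.

Let prob_far u : 0 < u -> fine (PX (far u)) = moving_weight d P * u^-1 `^ alpha *
    fine (\int[P \x leb]_y scaled_site_sum u^-1 (visible (cst 1%R)) y)%E.
Proof.
move=> u0; rewrite -(integral_far u0 (measurable_cst _) (fun=> ler01)).
by rewrite Rintegral_cst// mul1r.
Qed.

Let cvg_mass (b : nat -> R) : (forall n, 0 < b n) -> b n @[n --> \oo] --> 0 ->
  fine (\int[P \x leb]_y scaled_site_sum (b n) (visible (cst 1%R)) y)%E @[n --> \oo] --> c.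
Proof.
move=> b0 b_lim.
have := @cvg_visible (cst 1) 1 0 b (measurable_cst _) (fun=> ler01) (fun=> lexx _) (fun _ _ _ => erefl) b0 b_lim.
by rewrite Rintegral_cst// [fine _](congr1 fine (probability_setT PY)) !mulr1.
Qed.

(** The limit in [cvg_mass] is positive, hence so are the probabilities of high
    levels, and those of lower levels are larger. *)
Let far_gt0 u : (0 < PX (far u))%E.
Proof.
pose b n : R := n.+1%:R^-1.
have b0 n : 0 < b n by rewrite invr_gt0.
have b_lim : b n @[n --> \oo] --> 0 by exact: cvg_harmonic.
near \oo => n.
have un : u <= n.+1%:R.
  by rewrite (@le_trans _ _ n%:R) ?ler_nat//; near: n; exact: nbhs_infty_ger.
apply: (@lt_le_trans _ _ (PX (far n.+1%:R))); last first.
  by apply: le_measure; rewrite ?inE// => z /=; exact: le_lt_trans.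
have fine0 : 0 < fine (PX (far n.+1%:R)).
  rewrite prob_far// mulr_gt0 ?mulr_gt0 ?mw_gt0 ?powR_gt0 ?invr_gt0//.
  by near: n; exact: (cvgr_gt c (cvg_mass b0 b_lim)).
rewrite lt_neqAle measure_ge0 andbT; apply/eqP => far0.
by move: fine0; rewrite -far0 ltxx.
Unshelve. all: by end_near. Qed.

(** The weight and the power of [u] in [integral_far] cancel in the quotient. *)
Let cvg_ratio (g : Zdfield R d -> R) (B : R) (m0 : nat) :
  measurable_fun setT g -> (forall x, 0 <= g x) -> (forall x, g x <= B) ->
  (forall x y, (forall i, (absZ i <= m0)%N -> x i = y i) -> g x = g y) ->
  (\int[PX]_(z in far u) g (fscale u^-1 (X z))) / fine (PX (far u))
    @[u --> +oo] --> \int[PY]_z g (Y z).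
Proof.
move=> mg g0 gB glocal; apply/cvg_pinftyP => u u_lim.
(* [u n] is positive for large [n] only *)
pose v n := Num.max 1 (u n).
have v0 n : 0 < v n by rewrite lt_max ltr01.
have uv : \forall n \near \oo, v n = u n.
  by move/cvgryPge : u_lim => /(_ 1); apply: filterS => n; exact: max_r.
have v_lim : (v n)^-1 @[n --> \oo] --> 0.
  apply/gtr0_cvgV0; first exact: nearW.
  apply/cvgryPge => A; move/cvgryPge : u_lim => /(_ A); apply: filterS => n uA.
  by rewrite le_max uA orbT.
have vV0 n : 0 < (v n)^-1 by rewrite invr_gt0.
pose I h n := fine (\int[P \x leb]_y scaled_site_sum (v n)^-1 (visible h) y)%E.
apply: (@cvg_trans _ ((I g n / I (cst 1) n) @[n --> \oo])).
  apply: near_eq_cvg; near=> n.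
  have <- : v n = u n by near: n.
  rewrite integral_far// prob_far// -/(I g n) -/(I (cst 1) n).
  rewrite invfM mulrACA divff ?mul1r// gt_eqF//.
  by rewrite mulr_gt0 ?mw_gt0 ?powR_gt0.
have -> : \int[PY]_z g (Y z) = c * \int[PY]_z g (Y z) / c.
  by rewrite mulrC mulKf// lt0r_neq0.
apply: cvgM; first exact: cvg_visible glocal _ _.
by apply: cvgV; [exact: lt0r_neq0|exact: cvg_mass].
Unshelve. all: by end_near. Qed.

Lemma moving_tail_process : tail_process PX X PY Y.
Proof.
split => // m f cf [M fM].
have mf : measurable_fun setT (fun x : Zdfield R d => f (box_restr x)).
  exact: measurable_box_observable.
(* adding the bound makes the observable nonnegative *)
pose g (x : Zdfield R d) := f (box_restr x) + M.
have mg : measurable_fun setT g by exact: measurable_funD.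
have g0 x : 0 <= g x.
  by rewrite /g addrC -lerBlDl sub0r lerNl (le_trans _ (fM (box_restr x)))// -normrN ler_norm.
have gB x : g x <= M + M by rewrite lerD2r (le_trans (ler_norm _) (fM _)).
have glocal x y : (forall i, (absZ i <= m)%N -> x i = y i) -> g x = g y.
  move=> xy; rewrite /g; congr (f _ + _); apply/funext => -[i im].
  exact: xy.
have shiftY : \int[PY]_z f (box_restr (Y z)) = \int[PY]_z g (Y z) - M.
  rewrite (@Rintegral_shift _ _ _ PY setT measurableT _ M)//.
    by rewrite [fine _](congr1 fine (probability_setT PY)) mulr1.
  exact: measurableT_comp mf mY.
rewrite shiftY.
apply: (cvg_trans _ (cvgB (cvg_ratio mg g0 gB glocal) (cvg_cst M))).
apply: near_eq_cvg; apply: nearW => u /=.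
rewrite [in RHS](@Rintegral_shift _ _ _ PX _ (measurable_far u) _ M)//; last first.
  apply: (measurableT_comp mf).
  exact: (measurable_fscale (measurable_cst u^-1) mX).
rewrite mulrBl mulfK// gt_eqF// fine_gt0// far_gt0/=.
by rewrite ltey_eq fin_num_measure.
Qed.

End MovingTail.

Theorem proposition5p2 (R : realType) (d : nat) (d_gt0 : (0 < d)%N)
  (dO : measure_display) (O : measurableType dO) (P : probability O R)
  (C : O -> Zdfield R d) (kappa : O -> R) (alpha c : R)
  (C_l0 : random_element_l0 C) (alpha_gt0 : 0 < alpha)
  (cE : c%:E = (\esum_(k in [set: Zd d])
                  'E_P[(fun w => `|C w k| `^ alpha)%R])%E)
  (c_gt0 : 0 < c)
  (kappa_meas : measurable_fun setT kappa)
  (kappa_sign : forall w, kappa w = -1 \/ kappa w = 1)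
  (kappa_indep : independent_rv P kappa C) :
  (forall (dT : measure_display) (OT : measurableType dT)
      (PT : probability OT R) (Theta : OT -> Zdfield R d),
    random_element_l0 Theta ->
    mixture_representation P C kappa alpha c PT Theta ->
    spectral_tail_process PT Theta alpha) /\
  (forall (dX dY : measure_display) (OX : measurableType dX)
      (OY : measurableType dY) (PX : probability OX R) (X : OX -> Zdfield R d)
      (PY : probability OY R) (Y : OY -> Zdfield R d),
    stationary PX X -> tail_process PX X PY Y ->
    random_element_l0 Y -> tail_index PY Y alpha ->
    mixture_representation P C kappa alpha c PY (@spectral R d \o Y) ->
    (forall (dQ : measure_display) (OQ : measurableType dQ)
        (PQ : probability OQ R) (Q : OQ -> Zdfield R d),
      random_element_l0 Q -> tilted_law P C kappa alpha PQ Q ->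
      anchored_spectral_representative PY Y PQ Q) /\
    extremal_index PY Y =
      ('E_P[(fun w => fnorm (C w) `^ alpha)%R] /
       \esum_(k in [set: Zd d]) 'E_P[(fun w => `|C w k| `^ alpha)%R])%E).
Proof.
split=> [dT OT PT Theta Theta_l0 mix|].
  exists _, _, ((O * measurableTypeR R) * nat)%type, (OT * measurableTypeR R)%type,
    (moving_law d P), (moving_cluster C kappa alpha),
    (radial_law PT), (pareto_multiple alpha Theta); split.
  - exact: moving_stationary.
  - exact: (moving_tail_process C_l0 alpha_gt0 c_gt0 kappa_meas kappa_sign Theta_l0 mix).
  - exact: (pareto_multiple_tail_index alpha_gt0 kappa_sign Theta_l0 mix).
  - exact: (pareto_multiple_spectral alpha_gt0 kappa_sign Theta_l0 mix).
move=> dX dY OX OY PX X PY Y _ tailY Y_l0 indexY mixY; split.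
  move=> dQ OQ PQ Q Q_l0 tiltQ; split; first exact: anchoring_exists.
  move=> A ancA h ht hshift.
  exact: (anchored_spectralE C_l0 alpha_gt0 c_gt0 kappa_meas kappa_sign tailY
    Y_l0 indexY mixY cE Q_l0 tiltQ ancA ht hshift).
rewrite (extremal_indexE C_l0 alpha_gt0 c_gt0 kappa_meas kappa_sign tailY
  Y_l0 indexY mixY) -cE inver gt_eqF// muleC.
by rewrite unlock.
Qed.
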